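(* A permutation $\pi\in S_n$ is perfect (i.e. has a perfect tangle solving it) if and only if it admits a balanced marking.
   Context: Tangles: $S_n$ is the set of permutations of $\{1,\dots,n\}$, $\pi(p)$ the element at position $p$; we write $\pi=[\dots a\dots b\dots]$ if $a$ occurs at an earlier position than $b$. The swap $\sigma(i)$ exchanges the elements at positions $i,i+1$. Two permutations are adjacent if one is obtained from the other by swaps $\sigma(p_1),\dots,\sigma(p_k)$ ($k\ge0$) with pairwise $|p_i-p_j|\ge2$. A tangle is a finite sequence $\pi_0,\dots,\pi_m$ with consecutive permutations adjacent; it solves $\pi$ if $\pi_0=\pi$ and $\pi_m$ is the identity (by convention $\pi_0=\pi_1$, $\pi_{m-1}=\pi_m$). In the drawing, element $x$ at time $t$ is at $(p,-t)$ where $\pi_t(p)=x$, and path $x$ is the polyline through these points. A segment is a maximal straight piece of a path; a non-vertical segment is an L-segment if, traversed downward, it moves left, and an R-segment if it moves right. A tangle solving $\pi$ is simple if no two paths cross more than once (equivalently it has the minimum number of crossings), and perfect if it is simple and each path has at most one L-segment and at most one R-segment. Markings: an inversion of $\pi$ is a pair $(a,b)$ with $a>b$ and $\pi=[\dots a\dots b\dots]$. Element $i$ is right if it appears in some inversion $(i,j)$, left if it appears in some inversion $(j,i)$; left-straight if left but not right; right-straight if right but not left; a switchback if both. A marking is a function $M$ from $\{1,\dots,n\}$ to strings in letters $L,R$; it is a marking for $\pi$ if $M(i)=L$ for left-straight $i$, $M(i)=R$ for right-straight $i$, $M(i)\in\{LR,RL\}$ for switchbacks, and $M(i)=\emptyset$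 (empty string) otherwise. A quadruple $(a,b,c,d)$ is a rec in $\pi$ if $\pi=[\dots a\dots b\dots c\dots d\dots]$ and $\min\{a,b\}>\max\{c,d\}$. Given a marking $M$, $e$ is a left switchback of the rec if $M(e)=RL$, $\pi=[\dots a\dots e\dots b\dots]$, and $e$ lies strictly between $c$ and $d$ in value; $e$ is a right switchback if $M(e)=LR$, $\pi=[\dots c\dots e\dots d\dots]$, and $e$ lies strictly between $a$ and $b$ in value. The rec is regular if $a<b$ and $c<d$, irregular otherwise; balanced under $M$ if it has equally many left and right switchbacks; empty if it has no switchbacks. A marking $M$ for $\pi$ is balanced if every regular rec of $\pi$ is balanced and every irregular rec is empty under $M$. *)

(* Defs.v *)
From HB Require Import structures.
From mathcomp Require Import all_boot all_order all_fingroup all_algebra.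

Set Implicit Arguments.
Unset Strict Implicit.
Unset Printing Implicit Defensive.

(* MathComp world. Positions and elements are both 0-based, in 'I_n: for
   [pi : 'S_n], [pi p] is the element at position [p]. *)

Section Permutations.
Variable n : nat.
Implicit Types (pi rho : 'S_n) (a b c d e x y : 'I_n).

Definition position pi x : 'I_n := (pi^-1)%g x.

Definition before pi a b : bool := position pi a < position pi b.

Lemma swap_pos_subproof (i : 'I_n.-1) : i.+1 < n.
Proof. by rewrite -ltn_predRL. Qed.

Definition swap (i : 'I_n.-1) : 'S_n :=
  tperm (widen_ord (leq_pred n) i) (Ordinal (swap_pos_subproof i)).

(* Since [(s * t) p = t (s p)], multiplying on the left by [swap i] exchanges
   the elements at positions [i] and [i.+1]. *)
Definition apply_swaps pi (ps : seq 'I_n.-1) : 'S_n :=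
  foldl (fun rho i => (swap i * rho)%g) pi ps.

Definition nonoverlapping (i j : 'I_n.-1) : bool := (i + 2 <= j) || (j + 2 <= i).

Definition obtained_by_swaps pi rho : Prop :=
  exists2 ps : seq 'I_n.-1, pairwise nonoverlapping ps & rho = apply_swaps pi ps.

Definition adjacent pi rho : Prop :=
  obtained_by_swaps pi rho \/ obtained_by_swaps rho pi.

End Permutations.

(* A tangle [T] is the sequence [pi_0, ..., pi_m] with [m = (size T).-1]. *)
Section Tangles.
Variable n : nat.
Implicit Types (pi : 'S_n) (T : seq 'S_n) (x y : 'I_n) (s t u : nat).

Definition perm_at T t : 'S_n := nth 1%g T t.

(* The clauses on both ends are the convention [pi_0 = pi_1] and
   [pi_(m-1) = pi_m]. *)
Definition is_tangle T : Prop :=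
  [/\ 1 < size T,
      forall t, t.+1 < size T -> adjacent (perm_at T t) (perm_at T t.+1),
      perm_at T 0 = perm_at T 1
    & perm_at T (size T - 2) = perm_at T (size T - 1)].

Definition solves T pi : Prop :=
  perm_at T 0 = pi /\ perm_at T (size T).-1 = 1%g.

(* The paths [x] and [y] cross between the times [t] and [t.+1]. *)
Definition crosses_at T x y t : bool :=
  before (perm_at T t) x y != before (perm_at T t.+1) x y.

Definition simple T : Prop :=
  forall x y t u, t.+1 < size T -> u.+1 < size T ->
    crosses_at T x y t -> crosses_at T x y u -> t = u.

Definition point T x t : int * int :=
  ((position (perm_at T t) x)%:Z, - t%:Z)%R.

Definition collinear (P Q S : int * int) : Prop :=
  ((Q.1 - P.1) * (S.2 - P.2) = (S.1 - P.1) * (Q.2 - P.2))%R.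

(* The piece of path [x] between the times [s] and [t] is straight. *)
Definition straight T x s t : Prop :=
  forall u, s <= u <= t -> collinear (point T x s) (point T x u) (point T x t).

(* A maximal straight piece of the polyline necessarily starts and ends at
   vertices, so it is determined by its integer start and end times. *)
Definition segment T x s t : Prop :=
  [/\ s < t, t < size T, straight T x s t
    & forall s' t', s' <= s -> t <= t' -> t' < size T ->
        straight T x s' t' -> s' = s /\ t' = t].

Definition Lsegment T x s t : Prop :=
  segment T x s t /\ ((point T x t).1 < (point T x s).1)%R.

Definition Rsegment T x s t : Prop :=
  segment T x s t /\ ((point T x s).1 < (point T x t).1)%R.

Definition perfect_tangle T : Prop :=
  [/\ simple T,
      forall x s t s' t', Lsegment T x s t -> Lsegment T x s' t' ->
        s = s' /\ t = t'
    & forall x s t s' t', Rsegment T x s t -> Rsegment T x s' t' ->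
        s = s' /\ t = t'].

Definition perfect pi : Prop :=
  exists T, [/\ is_tangle T, solves T pi & perfect_tangle T].

End Tangles.

Inductive letter : Set := L | R.

Definition letter_eqb (l k : letter) : bool :=
  match l, k with L, L | R, R => true | _, _ => false end.

Lemma letter_eqP : Equality.axiom letter_eqb.
Proof. by case; case; constructor. Qed.

HB.instance Definition _ := hasDecEq.Build letter letter_eqP.

Section Markings.
Variable n : nat.
Implicit Types (pi : 'S_n) (M : 'I_n -> seq letter) (a b c d e i j : 'I_n).

Definition inversion pi a b : bool := (b < a) && before pi a b.

Definition is_right pi i : bool := [exists j, inversion pi i j].
Definition is_left pi i : bool := [exists j, inversion pi j i].
Definition left_straight pi i : bool := is_left pi i && ~~ is_right pi i.
Definition right_straight pi i : bool := is_right pi i && ~~ is_left pi i.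
Definition switchback pi i : bool := is_left pi i && is_right pi i.

Definition marking_for pi M : Prop :=
  forall i,
    [/\ left_straight pi i -> M i = [:: L],
        right_straight pi i -> M i = [:: R],
        switchback pi i -> M i = [:: L; R] \/ M i = [:: R; L]
      & ~~ is_left pi i -> ~~ is_right pi i -> M i = [::]].

Definition rec pi a b c d : bool :=
  [&& before pi a b, before pi b c, before pi c d & maxn c d < minn a b].

Definition between a b e : bool := minn a b < e < maxn a b.

Definition left_switchbacks pi M a b c d : {set 'I_n} :=
  [set e | [&& M e == [:: R; L], before pi a e, before pi e b & between c d e]].

Definition right_switchbacks pi M a b c d : {set 'I_n} :=
  [set e | [&& M e == [:: L; R], before pi c e, before pi e d & between a b e]].

Definition regular a b c d : bool := (a < b) && (c < d).

Definition balanced_rec pi M a b c d : Prop :=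
  #|left_switchbacks pi M a b c d| = #|right_switchbacks pi M a b c d|.

Definition empty_rec pi M a b c d : Prop :=
  left_switchbacks pi M a b c d = set0 /\ right_switchbacks pi M a b c d = set0.

Definition balanced_marking pi M : Prop :=
  marking_for pi M /\
  forall a b c d, rec pi a b c d ->
    if regular a b c d then balanced_rec pi M a b c d
    else empty_rec pi M a b c d.

End Markings.

(* Main.v *)
Require Import Defs.
From mathcomp Require Import all_boot all_order all_fingroup all_algebra.
From mathcomp Require Import zify ring lra.

(* In a perfect tangle the R-segment of [x] and the L-segment of [y] meet for
   every inversion [(x, y)], at a time t(x, y) and a position q(x, y).  Both
   segments have slope one, so q(x, y) - t(x, y) depends only on [x] and
   q(x, y) + t(x, y) only on [y]; hence q(a, c) + q(b, d) = q(b, c) + q(a, d)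
   for every rec.  On the other hand the marking alone tells which elements are
   to the left of a crossing, so that q can be computed from it, and the
   alternating sum of q over a rec is, up to signs, the number of right
   switchbacks minus the number of left switchbacks.

   The signs leave one gap: for a doubly decreasing rec the identity only yields
   equality of the two numbers.  The gap is closed by a forbidden pattern: there
   are no [x k j y] of relative order 4231 with [M k = RL] and [M j = LR].  A
   balanced marking may contain such conflicts, but then [k] and [j] are the
   corners of an increasing block of consecutive positions and values, and
   exchanging their marks keeps the marking balanced; a balanced marking that
   maximizes the sum of its RL elements is free of conflicts.

   Conversely, for a balanced marking without conflicts the position q(x, y) is
   well defined and, by the rec identities, of the form v(y) - u(x).  Performing
   the crossing of [x] and [y] at time u(x) + v(y) makes the crossings of each
   element consecutive in time, which gives a perfect tangle. *)

Set Implicit Arguments.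
Unset Strict Implicit.
Unset Printing Implicit Defensive.
Import Order.TTheory GRing.Theory Num.Theory.

(** * Adjacent permutations *)

Section Adjacency.
Variable n : nat.
Implicit Types (pi rho : 'S_n) (ps : seq 'I_n.-1) (x y : 'I_n).

Lemma swap_val (i : 'I_n.-1) (k : 'I_n) :
  swap i k = (if k == i :> nat then i.+1 else if k == i.+1 :> nat then nat_of_ord i
              else nat_of_ord k) :> nat.
Proof. by rewrite /swap permE /= -!val_eqE /=; do ![case: eqP => //=]. Qed.

(** Disjoint swaps touch each position at most once, so the fold reduces to a single case
    distinction. *)
Lemma apply_swaps_val pi rho ps (k : 'I_n) :
    pairwise (@nonoverlapping n) ps -> rho = apply_swaps pi ps ->
  exists2 l : 'I_n, rho k = pi l &
    l = (if nat_of_ord k \in [seq nat_of_ord i | i <- ps] then k.+1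
         else if nat_of_ord k \in [seq (nat_of_ord i).+1 | i <- ps] then k.-1
         else nat_of_ord k) :> nat.
Proof.
move=> + ->; elim: ps pi => [|i ps IHps] pi /=; first by exists k.
case/andP=> /allP hi /IHps-/(_ (swap i * pi)%g) [l -> lE].
exists (swap i l); first by rewrite permM.
rewrite swap_val !inE lE; clear l lE.
have h1 : nat_of_ord k \in [seq nat_of_ord i | i <- ps] ->
    (i + 2 <= k) || (k + 2 <= i).
  by case/mapP=> j /hi; rewrite /nonoverlapping => /[swap] ->.
have h2 : nat_of_ord k \in [seq (nat_of_ord i).+1 | i <- ps] ->
    (0 < k) && ((i + 2 <= k.-1) || (k.-1 + 2 <= i)).
  by case/mapP=> j /hi; rewrite /nonoverlapping => /[swap] ->.
move: h1 h2.
move: (nat_of_ord k \in [seq nat_of_ord i | i <- ps]).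
move: (nat_of_ord k \in [seq (nat_of_ord i).+1 | i <- ps]).
by move=> [] [] //= h1 h2; rewrite ?orbT ?orbF; do ![case: eqP => //=]; lia.
Qed.

Lemma position_inj pi : injective (position pi).
Proof. exact: perm_inj. Qed.

Lemma position_perm pi (k : 'I_n) : position pi (pi k) = k.
Proof. exact: permK. Qed.

Lemma perm_position pi x : pi (position pi x) = x.
Proof. exact: permKV. Qed.

(** Adjacency without lists of swaps; [adjacentP] shows the equivalence. *)
Definition close pi rho := forall x,
  position rho x <= (position pi x).+1 /\ position pi x <= (position rho x).+1.

Lemma obtained_close pi rho : obtained_by_swaps pi rho -> close pi rho.
Proof.
case=> ps psP rhoE x; have [l] := apply_swaps_val (position rho x) psP rhoE.
rewrite perm_position => xE; rewrite xE position_perm -xE => ->.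
by do ![case: ifP => _]; lia.
Qed.

Lemma close_sym pi rho : close pi rho -> close rho pi.
Proof. by move=> h x; have [] := h x. Qed.

(** Induction on the position of [x]: if the element [z] that takes the old place of [x] were not
    [y], it would come from the place just before, and the induction hypothesis would send [x]
    there. *)
Lemma close_swap pi rho x y : close pi rho ->
  position pi y = (position pi x).+1 :> nat ->
  position rho x = position pi y :> nat -> position rho y = position pi x :> nat.
Proof.
move=> h; have [k] := ubnP (position pi x); elim: k x y => // k IHk x y ltxk yE xE.
set z := rho (position pi x).
have zE : position rho z = position pi x by rewrite position_perm.
have [] := h z; rewrite zE => z1 z2.
have [zy|zNy] := eqVneq z y; first by rewrite -zy zE.
have [zx|zNx] := eqVneq z x; first by move: xE; rewrite -zx zE zx; lia.
have zNy' : position pi z != position pi y :> nat.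
  by rewrite val_eqE (inj_eq (@position_inj pi)).
have zNx' : position pi z != position pi x :> nat.
  by rewrite val_eqE (inj_eq (@position_inj pi)).
have : position rho x = position pi z :> nat by apply: IHk; rewrite ?zE; lia.
lia.
Qed.

Lemma close_obtained pi rho : close pi rho -> obtained_by_swaps pi rho.
Proof.
(* The swaps are placed where an element moves right; by [close_swap] no two such positions are
   consecutive. *)
move=> h; pose up (i : 'I_n.-1) :=
  position rho (pi (widen_ord (leq_pred n) i)) == i.+1 :> nat.
have upP (i j : 'I_n.-1) : up i -> up j -> j != i.+1 :> nat.
  move=> /eqP iU /eqP jU; apply/eqP => ij.
  move: (close_swap h (x := pi (widen_ord (leq_pred n) i))
           (y := pi (widen_ord (leq_pred n) j))).
  by rewrite !position_perm /= iU jU ij => /(_ erefl erefl); lia.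
have lt_enum : pairwise (fun i j : 'I_n.-1 => i < j) (enum 'I_n.-1).
  rewrite (_ : pairwise _ _ = pairwise ltn (map val (enum 'I_n.-1))).
    by rewrite val_enum_ord -sorted_pairwise ?iota_ltn_sorted //; apply: ltn_trans.
  by rewrite pairwise_map.
have ps_pairwise : pairwise (@nonoverlapping n) (filter up (enum 'I_n.-1)).
  have sub : {in up &, subrel (fun i j : 'I_n.-1 => i < j) (@nonoverlapping n)}.
    by move=> i j iU jU /= ij; have := upP _ _ iU jU; rewrite /nonoverlapping; lia.
  by apply: (sub_in_pairwise sub); [apply: filter_all|apply: pairwise_filter].
exists (filter up (enum 'I_n.-1)) => //; apply/permP => k.
have [l -> lE] := apply_swaps_val (pi := pi) k ps_pairwise erefl.
apply: (@position_inj rho); rewrite position_perm; apply: val_inj => /=.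
have upE i : (nat_of_ord i \in [seq nat_of_ord j | j <- filter up (enum 'I_n.-1)]) = up i.
  by rewrite (mem_map (@ord_inj n.-1)) mem_filter mem_enum andbT.
have upI (i : 'I_n) : position rho (pi i) = i.+1 :> nat ->
    nat_of_ord i \in [seq nat_of_ord j | j <- filter up (enum 'I_n.-1)].
  move=> iE; have ltin : i < n.-1 by rewrite ltn_predRL -iE.
  rewrite -[nat_of_ord i]/(nat_of_ord (Ordinal ltin)) upE /up -[X in _ == X]iE.
  by apply/eqP; congr (nat_of_ord (position rho (pi _))); apply: val_inj.
move: lE; case: ifP => [/mapP[i]|kN].
  rewrite mem_filter => /andP[/eqP iU _] ki lE; rewrite ki.
  have := close_swap h (x := pi (widen_ord (leq_pred n) i)) (y := pi l).
  by rewrite !position_perm /= => -> //; rewrite ?iU lE ki.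
case: ifP => [/mapP[i]|kN'].
  rewrite mem_filter => /andP[/eqP iU _] ki lE; rewrite ki -iU.
  by congr (nat_of_ord (position rho (pi _))); apply: val_inj; rewrite /= lE ki.
move=> /val_inj ->; have [] := h (pi k); rewrite position_perm => k1 k2.
have [kE|[//|kE]] : position rho (pi k) = k.+1 :> nat \/
   position rho (pi k) = k :> nat \/ (position rho (pi k)).+1 = k by lia.
  by rewrite upI in kN.
(* If [pi k] moved left, [close_swap] read from [rho] to [pi] shows that [rho k] came from the
   position just before [k] and moved right, against [kN']. *)
have := close_swap (close_sym h) (x := pi k) (y := rho k).
rewrite !position_perm kE => /(_ erefl erefl) rkE.
set j := position rho (pi k) in kE rkE *.
have rkE' : rho k = pi j by rewrite -[LHS](perm_position pi); congr (pi _); apply: val_inj.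
case/negP: (negbT kN'); rewrite -kE (map_comp S (@nat_of_ord _)); apply: map_f; apply: upI.
by rewrite -rkE' position_perm.
Qed.

Lemma adjacentP pi rho : adjacent pi rho <-> close pi rho.
Proof.
split=> [[/obtained_close //|/obtained_close/close_sym //]|h].
by left; apply: close_obtained.
Qed.
End Adjacency.

(** * Straight pieces of paths *)

Section Segments.
Variables (n : nat) (T : seq 'S_n) (x : 'I_n).
Let X s : int := (position (perm_at T s) x)%:Z%R.
Implicit Types (s t u : nat) (d : int).

Definition has_slope d s t := forall u, s <= u <= t -> (X u = X s + d * (u%:Z - s%:Z))%R.

Lemma straightE s t : straight T x s t <-> forall u, s <= u <= t ->
  ((X u - X s) * (s%:Z - t%:Z) = (X t - X s) * (s%:Z - u%:Z))%R.
Proof.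
by split=> h u hu; have := h u hu; rewrite /collinear /= -!/(X _); lra.
Qed.

Lemma has_slope_straight d s t : s <= t -> has_slope d s t -> straight T x s t.
Proof.
move=> lest h; apply/straightE => u hu; rewrite (h u hu) (h t); last by lia.
ring.
Qed.

Lemma straight_has_slope s t : s < t -> straight T x s t ->
  has_slope (X s.+1 - X s)%R s t.
Proof.
move=> ltst /straightE h u hu.
have h1 : s <= s.+1 <= t by lia.
have := h _ hu; have := h _ h1; set D := (X s.+1 - X s)%R => e1 e2.
have nz : ((t%:Z - s%:Z) != 0)%R by lia.
have e3 : (X t - X s = D * (t%:Z - s%:Z))%R.
  by move: e1; rewrite -addn1 PoszD; lra.
by apply: (mulIf nz); move: e2; rewrite e3; lra.
Qed.

Lemma has_slope_step d s t u : has_slope d s t -> s <= u < t ->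
  (X u.+1 = X u + d)%R.
Proof. by move=> h hu; rewrite (h u) ?(h u.+1); [ring|lia|lia]. Qed.

Lemma step_has_slope d s t : (forall u, s <= u < t -> (X u.+1 = X u + d)%R) ->
  has_slope d s t.
Proof.
move=> h; elim=> [|u IHu] hu; first by rewrite (_ : s = 0); [ring|lia].
have [->|nsu] := eqVneq s u.+1; first by ring.
by rewrite h ?IHu; [rewrite -addn1 PoszD; ring|lia|lia].
Qed.

Hypothesis step_le1 : forall s, s.+1 < size T -> (-1 <= X s.+1 - X s <= 1)%R.

(** The slope of a straight piece equals its first step, hence is -1, 0 or 1; the sign condition
    leaves only [d]. *)
Lemma segment_step d s t : (d = 1 \/ d = -1)%R -> segment T x s t ->
  (0 < d * (X t - X s))%R -> forall u, s <= u < t -> (X u.+1 = X u + d)%R.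
Proof.
move=> d1 [ltst ltt st _] dX u hu.
have sl := straight_has_slope ltst st.
rewrite (has_slope_step sl hu); congr (_ + _)%R.
have := sl t; rewrite leqnn (ltnW ltst) => /(_ isT) tE.
have := @step_le1 s; have -> : s.+1 < size T by lia.
move=> /(_ isT); move: tE dX; case: d1 => ->; nia.
Qed.

(** By convexity the hull of the two time intervals consists of steps [d], so it is straight, and
    maximality identifies both segments with it. *)
Lemma segment_uniq d s t s' t' : (d = 1 \/ d = -1)%R ->
    (forall u v w, u < v < w -> w.+1 < size T ->
       (X u.+1 = X u + d -> X w.+1 = X w + d -> X v.+1 = X v + d)%R) ->
    segment T x s t -> (0 < d * (X t - X s))%R ->
    segment T x s' t' -> (0 < d * (X t' - X s'))%R -> s = s' /\ t = t'.
Proof.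
move=> d1 conv seg dX seg' dX'.
have h := segment_step d1 seg dX; have h' := segment_step d1 seg' dX'.
case: seg seg' => [ltst ltt _ maxs] [ltst' ltt' _ maxs'].
have all_steps u : minn s s' <= u < maxn t t' -> (X u.+1 = X u + d)%R.
  move=> hu; have [/h //|n1] := boolP (s <= u < t).
  have [/h' //|n2] := boolP (s' <= u < t').
  have [lt|le] := ltnP u s.
    apply: (conv s' _ s); [lia|lia|apply: h'; lia|apply: h; lia].
  apply: (conv s _ s'); [lia|lia|apply: h; lia|apply: h'; lia].
have st : straight T x (minn s s') (maxn t t').
  by apply: (@has_slope_straight d); [lia|exact: step_has_slope].
have [|||e1 e2] := maxs _ _ _ _ _ st; try lia.
by have [|||e3 e4] := maxs' _ _ _ _ _ st; lia.
Qed.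

(** A longest run of steps [d] around [u] is a segment: any larger straight piece contains the step
    at [u], so it has slope [d] as well and is itself such a run. *)
Lemma step_segment d u : (d = 1 \/ d = -1)%R -> u.+1 < size T ->
  (X u.+1 = X u + d)%R ->
  exists s t, [/\ segment T x s t, s <= u < t & (0 < d * (X t - X s))%R].
Proof.
move=> d1 ltu du.
pose P (k : nat) := [exists st : 'I_(size T) * 'I_(size T),
  [&& st.1 <= u < st.2, k == st.2 - st.1 &
      [forall w : 'I_(size T), (st.1 <= w < st.2) ==> (X w.+1 == X w + d)%R]]].
have exP : exists k, P k.
  exists 1; apply/existsP; exists (Ordinal (ltnW ltu), Ordinal ltu) => /=.
  rewrite leqnn ltnSn subSnn eqxx /=; apply/forallP => w; apply/implyP => hw.
  by apply/eqP; have -> : w = u :> nat by lia.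
have ubP k : P k -> k <= size T.
  by case/existsP=> -[s t] /and3P[_ /eqP -> _] /=; have := ltn_ord t; lia.
case: (ex_maxnP exP ubP) => k /existsP[[s t] /= /and3P[hu /eqP kE /forallP stP]] kmax.
have steps w : s <= w < t -> (X w.+1 = X w + d)%R.
  move=> hw; have ltw : w < size T by have := ltn_ord t; lia.
  by apply/eqP; have /implyP := stP (Ordinal ltw); apply.
exists s, t; split=> //; last first.
  have := step_has_slope steps (u := t); have -> : s <= t <= t by lia.
  by move=> /(_ isT) ->; case: d1 => ->; lia.
split; [lia|exact: ltn_ord|by apply: has_slope_straight (step_has_slope steps); lia|].
move=> s' t' les let' ltt' st'.
have lts't' : s' < t' by lia.
have sl := straight_has_slope lts't' st'.
have dE : (X s'.+1 - X s' = d)%R.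
  have := has_slope_step sl (u := u); have -> : s' <= u < t' by lia.
  by move=> /(_ isT); rewrite du; lia.
have Pk : P (t' - s').
  have lts' : s' < size T by lia.
  apply/existsP; exists (Ordinal lts', Ordinal ltt') => /=.
  apply/and3P; split; [lia|by []|apply/forallP => w; apply/implyP => hw].
  by rewrite (has_slope_step sl hw) dE.
have := kmax _ Pk; lia.
Qed.

(** Converse of [segment_uniq]: the outer steps lie in one common segment, which contains the middle
    step. *)
Lemma steps_convex d : (d = 1 \/ d = -1)%R ->
    (forall s t s' t', segment T x s t -> (0 < d * (X t - X s))%R ->
       segment T x s' t' -> (0 < d * (X t' - X s'))%R -> s = s' /\ t = t') ->
  forall u v w, u < v < w -> w.+1 < size T ->
    (X u.+1 = X u + d -> X w.+1 = X w + d -> X v.+1 = X v + d)%R.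
Proof.
move=> d1 uniq u v w uvw ltw du dw.
have [|s [t [seg hu dX]]] := step_segment d1 _ du; first by lia.
have [s' [t' [seg' hw dX']]] := step_segment d1 ltw dw.
have [sE tE] := uniq _ _ _ _ seg dX seg' dX'.
by apply: (segment_step d1 seg dX); lia.
Qed.

End Segments.

(** * The side of an element at a crossing *)

Section CrossingOrder.
Variables (n : nat) (pi : 'S_n) (M : 'I_n -> seq letter).
Implicit Types a b c d e x y z k j : 'I_n.
Local Notation inv := (inversion pi).
Local Notation p x := (nat_of_ord (position pi x)).
Local Notation LR := [:: L; R].
Local Notation RL := [:: R; L].

Lemma pos_eq x y : (p x == p y) = (x == y :> nat).
Proof. by rewrite !val_eqE (inj_eq (@position_inj _ pi)). Qed.

(* An R-segment crossing the L-segments of both [z] and [y] meets that of [z]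
   first.  If [z] and [y] cross each other, the marking of the switchback among
   them decides. *)
Definition left_first z y :=
  if inv z y then M z == LR else if inv y z then M y == RL else before pi z y.

(* An L-segment crossing the R-segments of both [x] and [z] meets that of [x]
   first. *)
Definition right_first x z :=
  if inv z x then M x == RL else if inv x z then M z == LR else before pi z x.

(* [z] is to the left of the crossing of the R-segment of [x] with the L-segment
   of [y]. *)
Definition left_of z x y :=
  if inv x z then left_first z y
  else if inv z x then M x == RL else before pi z x.

Definition crossing_pos x y := #|[set z | left_of z x y]|.

Definition no_conflict := forall x k j y,
  inv x k -> inv x j -> inv k y -> inv j y -> before pi k j -> k < j ->
  M k = RL -> M j = LR -> False.

(** What the comparison of crossings needs from [marking_for]: at a switchback the two tests on the
    mark are complementary. *)
Definition switchbacks_marked := forall x z y,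
  inv x z -> inv z y -> (M z == LR) = (M z != RL).

Lemma marking_switchbacks : marking_for pi M -> switchbacks_marked.
Proof.
move=> mk x z y xz zy; have [_ _ + _] := mk z.
have -> : switchback pi z by apply/andP; split; apply/existsP; [exists x|exists y].
by move=> /(_ isT) [->|->].
Qed.

Hypothesis mk : switchbacks_marked.

Lemma left_of_diff x y y' z :
  ((left_of z x y : int) - (left_of z x y' : int) =
   (inv x z : int) * ((left_first z y : int) - (left_first z y' : int)))%R.
Proof. by rewrite /left_of; case: ifP => _; rewrite ?mul1r ?mul0r ?subrr. Qed.

Lemma recP a b c d : rec pi a b c d ->
  [/\ p a < p b, p b < p c & p c < p d] /\ [/\ c < a, c < b, d < a & d < b].
Proof.
by case/and4P=> ab bc cd; rewrite gtn_max !leq_min => /andP[/andP[-> ->] /andP[-> ->]].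
Qed.

Lemma left_first_before z y : p z < p y ->
  left_first z y = (z < y) || (M z == LR).
Proof.
rewrite /left_first /inversion /before => zy; rewrite zy (leq_gtF (ltnW zy)).
have := pos_eq z y; rewrite (ltn_eqF zy) !andbF andbT => /esym/negbT.
by case: ltngtP.
Qed.

Lemma left_first_gt z y : y < z -> left_first z y = (p z < p y) && (M z == LR).
Proof.
rewrite /left_first /inversion /before => yz; rewrite yz (leq_gtF (ltnW yz)) /=.
by case: ifP.
Qed.

(** The contribution of a single [z] to [crossing_pos_rec]. With the terms grouped by R-segment,
    [left_of_diff] keeps a group only if [z] crosses that segment. *)
Lemma left_of_rec a b c d z : rec pi a b c d ->
  ((left_of z a c : int) + (left_of z b d : int)
     - (left_of z b c : int) - (left_of z a d : int) =
   (if (a < b)%N then (z \in right_switchbacks pi M a b c d : int)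
    else - (z \in right_switchbacks pi M a b c d : int))
   - (if (c < d)%N then (z \in left_switchbacks pi M a b c d : int)
      else - (z \in left_switchbacks pi M a b c d : int)))%R.
Proof.
move=> /recP[[ab bc cd] [ca cb da db]].
have -> : ((left_of z a c : int) + (left_of z b d : int)
     - (left_of z b c : int) - (left_of z a d : int) =
   ((left_of z a c : int) - (left_of z a d : int)) -
   ((left_of z b c : int) - (left_of z b d : int)))%R by lra.
rewrite !left_of_diff !inE /inversion /before /between.
(* After [b] only the right switchback term can be nonzero, up to [b] only the left one. *)
have [zb|bz] := leqP (p z) (p b); last first.
  rewrite [p z < p b]ltnNge (ltnW bz) /= !andbF /= !andbT (ltn_trans ab bz) !andbT.
  have [/andP[zlta zltb]|nab] := boolP ((z < a) && (z < b)).
    rewrite zlta zltb; have -> : minn a b < z = false by lia.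
    by rewrite !andbF /=; do 2!case: ifP => _; rewrite ?oppr0 subrr.
  have [nbt|bt] := boolP ((minn a b <= z) && (z < maxn a b)); last first.
    have -> : z < a = false by lia. have -> : z < b = false by lia.
    have -> : z < maxn a b = false by lia.
    by rewrite !andbF /=; do 2!case: ifP => _; rewrite !mul0r ?oppr0 subrr.
  have za := pos_eq a z; have zb := pos_eq b z.
  have bt : (minn a b < z) && (z < maxn a b) by lia.
  rewrite !left_first_gt; try lia.
  rewrite bt andbT; move: (M z == LR) => lr.
  have zc := pos_eq z c; have zd := pos_eq z d.
  have -> : (((p z < p c)%N && lr : int) - ((p z < p d)%N && lr : int) =
     - ([&& lr, (p c < p z)%N & (p z < p d)%N] : int))%R.
    clear -bt ca cb da db cd zc zd; case: lr; rewrite ?andbT ?andbF //=.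
    have [zpc|cpz] := ltnP (p z) (p c); have [zpd|dpz] := ltnP (p z) (p d); lia.
  case: ifP => ab'; have -> : z < a = ~~ (a < b) by lia.
  - have -> : z < b = (a < b) by lia.
    by rewrite ab' /=; case: ifP => _; rewrite ?oppr0 subr0 mul0r mul1r opprK add0r.
  have -> : z < b = (a < b) by lia.
  by rewrite ab' /=; case: ifP => _; rewrite ?oppr0 !subr0 mul0r mul1r subr0.
have zc : p z < p c by lia.
have zd : p z < p d by lia.
rewrite !left_first_before // andbF /= mul0r subr0.
rewrite [p c < p z]ltnNge (ltnW zc) !andbF /=.
rewrite (_ : (if (a < b)%N then _ else _) = 0)%R; last by case: ifP.
have [az|za] := leqP a z.
  have -> : minn c d < z by lia. have -> : z < maxn c d = false by lia.
  by rewrite !andbF /=; case: ifP => _; rewrite mul0r ?oppr0 subrr.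
have [paz|_] := ltnP (p a) (p z); last first.
  by rewrite !andbF /=; case: ifP => _; rewrite mul0r ?oppr0 subrr.
have zcE := pos_eq z c; have zdE := pos_eq z d; have zbE := pos_eq z b.
have mkc := @mk a z c; have mkd := @mk a z d.
move: mkc mkd; rewrite /inversion /before za paz zc zd.
move: (M z == LR) (M z == RL) => lr rl mkc mkd /=.
case: ifP => cd'; rewrite mul1r.
  have [|] := ltnP c z => ?; have [|] := ltnP d z => ?; move: mkc mkd; lia.
have [|] := ltnP c z => ?; have [|] := ltnP d z => ?; move: mkc mkd; lia.
Qed.

Lemma left_first_irr z : left_first z z = false.
Proof. by rewrite /left_first /inversion /before !ltnn. Qed.

Lemma right_first_irr z : right_first z z = false.
Proof. by rewrite /right_first /inversion /before !ltnn. Qed.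

(** If [z] and [y] are inverted, the common [x] makes the smaller-positioned one a switchback, to
    which [mk] applies. *)
Lemma left_first_total x z y : inv x z -> inv x y -> z != y ->
  left_first z y = ~~ left_first y z.
Proof.
move=> xz xy zy; rewrite /left_first.
have mz := mk xz (y := y); have my := mk xy (y := z).
have [zyI|_] := boolP (inv z y).
  have -> : inv y z = false by move: zyI; rewrite /inversion /before; lia.
  exact: mz.
have [yzI|_] := boolP (inv y z); first by rewrite my ?negbK.
by rewrite /before -leqNgt [RHS]leq_eqVlt pos_eq val_eqE (negPf zy).
Qed.

Lemma right_first_total y x z : inv x y -> inv z y -> x != z ->
  right_first x z = ~~ right_first z x.
Proof.
move=> xy zy xz; rewrite /right_first.
have mx := @mk z x y; have mz := @mk x z y.
have [zxI|_] := boolP (inv z x).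
  have -> : inv x z = false by move: zxI; rewrite /inversion /before; lia.
  by rewrite mx ?negbK.
have [xzI|_] := boolP (inv x z); first exact: mz.
by rewrite /before -leqNgt [RHS]leq_eqVlt pos_eq val_eqE eq_sym (negPf xz).
Qed.

End CrossingOrder.

(** * Ranks in a finite strict total order *)

Section Rank.
Variables (T : finType) (A : {set T}) (R : rel T).
Hypothesis R_irr : irreflexive R.
Hypothesis R_trans : forall x y z, x \in A -> y \in A -> z \in A ->
  R x y -> R y z -> R x z.
Hypothesis R_total : forall x y, x \in A -> y \in A -> x != y -> R x y = ~~ R y x.

Let rank x := #|[set z in A | R z x]|.

Lemma rank_lt x y : x \in A -> y \in A -> R x y -> rank x < rank y.
Proof.
move=> xA yA xy; apply: proper_card; apply/properP; split.
  apply/subsetP => z; rewrite !inE => /andP[zA zx]; rewrite zA.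
  exact: R_trans zx xy.
by exists x; rewrite !inE ?xA // R_irr andbF.
Qed.

(** The ranks are distinct and below [#|A|], so by counting they exhaust that range. *)
Lemma rank_surj i : i < #|A| -> exists2 x, x \in A & rank x = i.
Proof.
have rank_inj : {in A &, injective rank}.
  move=> x y xA yA rxy; apply/eqP/negPn/negP => xy.
  have [/(rank_lt xA yA)|] := boolP (R x y); first by rewrite rxy ltnn.
  by rewrite R_total // negbK => /(rank_lt yA xA); rewrite rxy ltnn.
have sub : {subset [seq rank x | x <- enum A] <= iota 0 #|A|}.
  move=> j /mapP[x]; rewrite mem_enum => xA ->; rewrite mem_iota add0n /=.
  apply: proper_card; apply/properP; split.
    by apply/subsetP => z; rewrite inE => /andP[].
  by exists x; rewrite ?inE // R_irr andbF.
have uniq_ranks : uniq [seq rank x | x <- enum A].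
  by rewrite map_inj_in_uniq ?enum_uniq // => x y; rewrite !mem_enum; apply: rank_inj.
have [|_ eq_mem] := uniq_min_size uniq_ranks sub; first by rewrite size_map size_iota cardE.
move=> lti; have : i \in iota 0 #|A| by rewrite mem_iota.
by rewrite -eq_mem => /mapP[x]; rewrite mem_enum => xA ->; exists x.
Qed.

Lemma rank_between x y i : x \in A -> y \in A -> rank x <= i <= rank y ->
  exists2 z, z \in A & rank z = i.
Proof.
move=> xA yA /andP[_ iy]; apply: rank_surj; apply: leq_ltn_trans iy _.
apply: proper_card; apply/properP; split.
  by apply/subsetP => z; rewrite inE => /andP[].
by exists y; rewrite ?inE // R_irr andbF.
Qed.

End Rank.

(** * Crossing positions as ranks in the absence of conflicts *)

Section NoConflict.
Variables (n : nat) (pi : 'S_n) (M : 'I_n -> seq letter).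
Implicit Types a b c d e x y z k j : 'I_n.
Local Notation inv := (inversion pi).
Local Notation p x := (nat_of_ord (position pi x)).
Local Notation LR := [:: L; R].
Local Notation RL := [:: R; L].
Hypothesis mk : switchbacks_marked pi M.
Hypothesis noconf : no_conflict pi M.

(** The excluded pattern as a boolean fit for [lia]: it makes [j] a switchback, so that a mark other
    than RL is LR. *)
Lemma no_conflict_RL x k j y : inv x k -> inv x j -> M k == RL -> M j != RL ->
  ~~ [&& p k < p j, k < j, y < k & p j < p y].
Proof.
move=> xk xj kM jM; apply/negP => /and4P[kj kj' yk jy].
have jyI : inv j y by rewrite /inversion /before jy (ltn_trans yk kj').
have kyI : inv k y by rewrite /inversion /before yk (ltn_trans kj jy).
by apply: (noconf xk xj kyI jyI kj kj' (eqP kM)); apply/eqP; rewrite (mk xj jyI).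
Qed.

(** Two RL elements compare by value, two others by position, and in a mixed pair the RL element is
    first only if it is smaller in both. This turns transitivity into linear arithmetic. *)
Lemma left_firstE x z y : inv x z -> inv x y ->
  left_first pi M z y =
    if M z == RL then (if M y == RL then z < y else (p z < p y) && (z < y))
    else if M y == RL then (p z < p y) || (z < y) else p z < p y.
Proof.
move=> /mk mz /mk my; have e := pos_eq pi z y.
rewrite /left_first; case: ifP => [zy|zyN].
  rewrite (mz _ zy); move: zy; rewrite /inversion /before => /andP[yz zy].
  by rewrite zy (leq_gtF (ltnW yz)); do !case: ifP.
case: ifP => [yz|yzN].
  move: yz; rewrite /inversion /before => /andP[yz zy].
  by rewrite yz (leq_gtF (ltnW zy)) orbT; do !case: ifP.
move: zyN yzN e; clear; rewrite /inversion /before.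
by case: (M z == RL); case: (M y == RL); lia.
Qed.

Lemma left_first_trans x y1 y2 y3 : inv x y1 -> inv x y2 -> inv x y3 ->
  left_first pi M y1 y2 -> left_first pi M y2 y3 -> left_first pi M y1 y3.
Proof.
move=> i1 i2 i3; rewrite (left_firstE i1 i2) (left_firstE i2 i3) (left_firstE i1 i3).
(* Each ordered pair of the three serves as [(k, j)], with the remaining element as the end of the
   pattern. *)
have n12 := no_conflict_RL y3 i1 i2; have n23 := no_conflict_RL y1 i2 i3.
have n31 := no_conflict_RL y2 i3 i1; have n13 := no_conflict_RL y2 i1 i3.
have n21 := no_conflict_RL y3 i2 i1; have n32 := no_conflict_RL y1 i3 i2.
have := pos_eq pi y1 y2; have := pos_eq pi y1 y3; have := pos_eq pi y2 y3.
(* [lia] sees only numbers, so it must be told that equal elements have equal marks. *)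
have : (y1 == y3 :> nat) -> (M y1 == RL) = (M y3 == RL) by move/eqP/val_inj->.
move: n12 n23 n31 n13 n21 n32; clear.
case: (M y1 == RL); case: (M y2 == RL); case: (M y3 == RL) => //= n1 n2 n3 n4 n5 n6;
  do 6?[match goal with H : is_true true -> is_true false -> _ |- _ => clear H
   | H : is_true true -> is_true true -> _ |- _ => move: (H isT isT) => {}H
   | H : is_true false -> _ |- _ => clear H end]; lia.
Qed.

Lemma right_firstE y x z : inv x y -> inv z y ->
  right_first pi M x z =
    if M x == LR then (if M z == LR then z < x else (p z < p x) && (z < x))
    else if M z == LR then (p z < p x) || (z < x) else p z < p x.
Proof.
move=> xy zy; have e := pos_eq pi x z.
rewrite /right_first; case: ifP => [zx|zxN].
  have -> : (M x == RL) = (M x != LR) by rewrite (mk zx xy) negbK.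
  move: zx; rewrite /inversion /before => /andP[xz zx].
  by rewrite zx (leq_gtF (ltnW xz)); do !case: ifP.
case: ifP => [xz|xzN].
  move: xz; rewrite /inversion /before => /andP[zltx xz].
  by rewrite zltx (leq_gtF (ltnW xz)) orbT; do !case: ifP.
move: zxN xzN e; clear; rewrite /inversion /before.
by case: (M z == LR); case: (M x == LR); lia.
Qed.

Lemma no_conflict_LR x k j y : inv k y -> inv j y -> M k != LR -> M j == LR ->
  ~~ [&& p k < p j, k < j, j < x & p x < p k].
Proof.
move=> ky jy kM jM; apply/negP => /and4P[kj kj' jx xk].
have xkI : inv x k by rewrite /inversion /before xk (ltn_trans kj' jx).
have xjI : inv x j by rewrite /inversion /before jx (ltn_trans xk kj).
apply: (noconf xkI xjI ky jy kj kj' _ (eqP jM)); apply/eqP.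
by move: kM; rewrite (mk xkI ky) negbK.
Qed.

Lemma right_first_trans y x1 x2 x3 : inv x1 y -> inv x2 y -> inv x3 y ->
  right_first pi M x1 x2 -> right_first pi M x2 x3 -> right_first pi M x1 x3.
Proof.
move=> i1 i2 i3; rewrite (right_firstE i1 i2) (right_firstE i2 i3) (right_firstE i1 i3).
have n12 := no_conflict_LR x3 i1 i2; have n23 := no_conflict_LR x1 i2 i3.
have n31 := no_conflict_LR x2 i3 i1; have n13 := no_conflict_LR x2 i1 i3.
have n21 := no_conflict_LR x3 i2 i1; have n32 := no_conflict_LR x1 i3 i2.
have := pos_eq pi x1 x2; have := pos_eq pi x1 x3; have := pos_eq pi x2 x3.
have : (x1 == x3 :> nat) -> (M x1 == LR) = (M x3 == LR) by move/eqP/val_inj->.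
move: n12 n23 n31 n13 n21 n32; clear.
case: (M x1 == LR); case: (M x2 == LR); case: (M x3 == LR) => //= n1 n2 n3 n4 n5 n6;
  do 6?[match goal with H : is_true true -> is_true false -> _ |- _ => clear H
   | H : is_true true -> is_true true -> _ |- _ => move: (H isT isT) => {}H
   | H : is_true false -> _ |- _ => clear H end]; lia.
Qed.

(* [left_of] refers only to the relations of [z] with [x], except when [z] crosses
   the R-segment of [x]; this is the mirror description, seen from [y]. *)
Lemma left_of_rightE x y z : inv x y ->
  left_of pi M z x y = if inv z y then right_first pi M x z
                       else if inv y z then M y == RL else before pi z y.
Proof.
move=> xy; have zxy := @mk x z y; have ex := pos_eq pi x z; have ey := pos_eq pi y z.
rewrite /left_of /left_first /right_first.
have [xz|xzN] := boolP (inv x z).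
  have -> : inv z x = false by move: xz; clear; rewrite /inversion /before; lia.
  have [zy|zyN] := boolP (inv z y); first by [].
  by case: ifP.
have [zx|zxN] := boolP (inv z x).
  have -> // : inv z y by move: zx xy; clear; rewrite /inversion /before; lia.
have [zy|zyN] := boolP (inv z y); first by [].
have -> : inv y z = false.
  by move: xzN xy; clear; rewrite /inversion /before; lia.
by move: ex ey xzN zxN zyN xy; clear; rewrite /inversion /before; lia.
Qed.

(** Along the R-segment of [x] the position is a constant plus a rank for [left_first]; hence it is
    monotone and skips no intermediate value. *)
Lemma crossing_pos_leftE x : exists m, forall y,
  crossing_pos pi M x y = m + #|[set z in [set z | inv x z] | left_first pi M z y]|.
Proof.
(* For [z] not inverted with [x], [left_of] ignores its last argument, which the second [x] merely
   fills. *)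
exists #|[set z | ~~ inv x z & left_of pi M z x x]| => y.
rewrite /crossing_pos -(cardsID [set z | inv x z]) addnC; congr (_ + _).
  apply: eq_card => z; rewrite !inE /left_of; by case: ifP.
by apply: eq_card => z; rewrite !inE /left_of andbC; case: ifP.
Qed.

Lemma crossing_pos_rightE y : exists m, forall x, inv x y ->
  crossing_pos pi M x y = m + #|[set z in [set z | inv z y] | right_first pi M x z]|.
Proof.
exists #|[set z | ~~ inv z y & if inv y z then M y == RL else before pi z y]| => x xy.
rewrite /crossing_pos -(cardsID [set z | inv z y]) addnC; congr (_ + _).
  by apply: eq_card => z; rewrite !inE left_of_rightE //; case: ifP.
by apply: eq_card => z; rewrite !inE left_of_rightE // andbC; case: ifP.
Qed.

Lemma crossing_pos_left_lt x y1 y2 : inv x y1 -> inv x y2 ->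
  left_first pi M y1 y2 -> crossing_pos pi M x y1 < crossing_pos pi M x y2.
Proof.
move=> xy1 xy2 y12; have [m mE] := crossing_pos_leftE x; rewrite !mE ltn_add2l.
apply: (rank_lt (R := left_first pi M)) y12; rewrite ?inE //; first exact: left_first_irr.
by move=> u v w; rewrite !inE; apply: left_first_trans.
Qed.

Lemma crossing_pos_left_between x y1 y2 i : inv x y1 -> inv x y2 ->
  crossing_pos pi M x y1 <= i <= crossing_pos pi M x y2 ->
  exists2 y, inv x y & crossing_pos pi M x y = i.
Proof.
move=> xy1 xy2; have [m mE] := crossing_pos_leftE x; rewrite !mE => hi.
have tr : forall u v w, u \in [set z | inv x z] -> v \in [set z | inv x z] ->
    w \in [set z | inv x z] -> left_first pi M u v -> left_first pi M v w ->
    left_first pi M u w.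
  by move=> u v w; rewrite !inE; apply: left_first_trans.
have tot : forall u v, u \in [set z | inv x z] -> v \in [set z | inv x z] ->
    u != v -> left_first pi M u v = ~~ left_first pi M v u.
  by move=> u v; rewrite !inE; apply: (left_first_total mk).
have := rank_between (@left_first_irr _ pi M) tr tot (x := y1) (y := y2) (i := i - m).
rewrite !inE => /(_ xy1 xy2) [|y]; first by lia.
by rewrite inE => xy yE; exists y; rewrite // mE; lia.
Qed.

(** The order is reversed here: an L-segment moves left, so its later crossings lie further left. *)
Lemma crossing_pos_right_lt y x1 x2 : inv x1 y -> inv x2 y ->
  right_first pi M x1 x2 -> crossing_pos pi M x2 y < crossing_pos pi M x1 y.
Proof.
move=> x1y x2y x12; have [m mE] := crossing_pos_rightE y; rewrite !mE // ltn_add2l.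
have tr : forall u v w, u \in [set z | inv z y] -> v \in [set z | inv z y] ->
    w \in [set z | inv z y] -> right_first pi M v u -> right_first pi M w v ->
    right_first pi M w u.
  by move=> u v w; rewrite !inE => uy vy wy vu wv; exact: right_first_trans wy vy uy wv vu.
have := rank_lt (R := fun z x => right_first pi M x z)
  (@right_first_irr _ pi M) tr (x := x2) (y := x1).
by rewrite !inE; apply.
Qed.

Lemma crossing_pos_right_between y x1 x2 i : inv x1 y -> inv x2 y ->
  crossing_pos pi M x1 y <= i <= crossing_pos pi M x2 y ->
  exists2 x, inv x y & crossing_pos pi M x y = i.
Proof.
move=> x1y x2y; have [m mE] := crossing_pos_rightE y; rewrite !mE // => hi.
have tr : forall u v w, u \in [set z | inv z y] -> v \in [set z | inv z y] ->
    w \in [set z | inv z y] -> right_first pi M v u -> right_first pi M w v ->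
    right_first pi M w u.
  by move=> u v w; rewrite !inE => uy vy wy vu wv; exact: right_first_trans wy vy uy wv vu.
have tot : forall u v, u \in [set z | inv z y] -> v \in [set z | inv z y] ->
    u != v -> right_first pi M v u = ~~ right_first pi M u v.
  by move=> u v; rewrite !inE => uy vy uv; rewrite (right_first_total mk vy uy) 1?eq_sym.
have := rank_between (R := fun z x => right_first pi M x z)
  (@right_first_irr _ pi M) tr tot (x := x1) (y := x2) (i := i - m).
rewrite !inE => /(_ x1y x2y) [|x]; first by lia.
by rewrite inE => xy xE; exists x; rewrite // mE //; lia.
Qed.

End NoConflict.

(** * Recs and crossing positions *)

Lemma card_sumZ (T : finType) (P : pred T) :
  (#|[set z | P z]|%:Z = \sum_z (P z)%:Z)%R.
Proof.
by rewrite -sum1dep_card big_mkcond (big_morph Posz PoszD (erefl 0%R)).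
Qed.

Section CrossingPositions.
Variables (n : nat) (pi : 'S_n) (M : 'I_n -> seq letter).
Implicit Types a b c d e x y z k j : 'I_n.
Local Notation inv := (inversion pi).
Local Notation p x := (nat_of_ord (position pi x)).
Local Notation cp := (crossing_pos pi M).
Hypothesis mk : switchbacks_marked pi M.

Lemma crossing_pos_rec a b c d : rec pi a b c d ->
  ((cp a c)%:Z + (cp b d)%:Z - (cp b c)%:Z - (cp a d)%:Z =
   (if (a < b)%N then #|right_switchbacks pi M a b c d|%:Z
    else - #|right_switchbacks pi M a b c d|%:Z)
   - (if (c < d)%N then #|left_switchbacks pi M a b c d|%:Z
      else - #|left_switchbacks pi M a b c d|%:Z))%R.
Proof.
have cpE x y : ((cp x y)%:Z = \sum_z (left_of pi M z x y)%:Z)%R by exact: card_sumZ.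
move=> abcd; rewrite !cpE -big_split -!sumrB /=.
rewrite (eq_bigr _ (fun z _ => left_of_rec mk z abcd)).
have setE (A : {set 'I_n}) : (#|A|%:Z = \sum_z (z \in A)%:Z)%R.
  by rewrite -card_sumZ; congr (Posz #|pred_of_set _|); apply/setP => z; rewrite inE.
by case: ifP => _; case: ifP => _; rewrite !setE sumrB ?sumrN.
Qed.

(** The condition under which the position splits into a function of [y] minus a function of [x];
    see [crossing_potential]. *)
Definition parallelogram := forall x x' y y',
  inv x y -> inv x' y -> inv x y' -> inv x' y' ->
  cp x y + cp x' y' = cp x' y + cp x y'.

Lemma inversion_rec x x' y y' : inv x y -> inv x' y -> inv x y' -> inv x' y' ->
  p x < p x' -> p y < p y' -> rec pi x x' y y'.
Proof. by rewrite /rec /inversion /before; lia. Qed.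

Lemma balanced_parallelogram : balanced_marking pi M -> parallelogram.
Proof.
(* The identity is symmetric in [x], [x'] and in [y], [y'], and trivial if either pair coincides;
   what remains is a rec. *)
case=> _ bal x x' y y'; wlog xx' : x x' / p x < p x' => [hw xy x'y xy' x'y'|].
  case: (ltngtP (p x) (p x')) => [lt|gt|/eqP]; first exact: hw.
  - by symmetry; apply: hw.
  - by rewrite pos_eq val_eqE => /eqP ->.
wlog yy' : y y' / p y < p y' => [hw xy x'y xy' x'y'|].
  case: (ltngtP (p y) (p y')) => [lt|gt|/eqP]; first exact: hw.
  - by rewrite addnC [RHS]addnC; symmetry; apply: hw.
  - by rewrite pos_eq val_eqE => /eqP ->; rewrite addnC.
move=> xy x'y xy' x'y'; have r := inversion_rec xy x'y xy' x'y' xx' yy'.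
have := crossing_pos_rec r; have := bal _ _ _ _ r; rewrite /regular.
case: ifP => [/andP[-> ->]|_]; first by rewrite /balanced_rec; lia.
by case=> -> ->; rewrite !cards0; do 2!case: ifP => _; lia.
Qed.

(** If exactly one of the pairs [a, b] and [c, d] is increasing, the signs agree and a sum of two
    cardinals vanishes. Otherwise their difference vanishes, which settles the regular case. *)
Lemma parallelogram_balanced : no_conflict pi M -> parallelogram ->
  forall a b c d, rec pi a b c d ->
    if regular a b c d then balanced_rec pi M a b c d
    else empty_rec pi M a b c d.
Proof.
move=> noconf par a b c d r; have [[ab bc cd] [ca cb da db]] := recP r.
have := crossing_pos_rec r.
have -> : ((cp a c)%:Z + (cp b d)%:Z - (cp b c)%:Z - (cp a d)%:Z = 0)%R.
  have [h1 h2 h3 h4] : [/\ inv a c, inv b c, inv a d & inv b d].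
    by rewrite /inversion /before; split; lia.
  by have := par a b c d h1 h2 h3 h4; lia.
rewrite /regular /balanced_rec /empty_rec.
case: ifP => ab'; case: ifP => cd' /= e; first by lia.
- move: e; rewrite opprK -PoszD => -[/esym/eqP].
  by rewrite addn_eq0 => /andP[/eqP/cards0_eq -> /eqP/cards0_eq ->].
- move/esym/eqP: e; rewrite -opprD oppr_eq0 -PoszD => /eqP[/eqP].
  by rewrite addn_eq0 => /andP[/eqP/cards0_eq -> /eqP/cards0_eq ->].
have {}e : #|left_switchbacks pi M a b c d| = #|right_switchbacks pi M a b c d|.
  by move/esym/eqP: e; rewrite opprK addrC subr_eq0 => /eqP[].
have [l0|[e1]] := set_0Vmem (left_switchbacks pi M a b c d).
  by split=> //; apply: cards0_eq; rewrite -e l0 cards0.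
have [r0|[f]] := set_0Vmem (right_switchbacks pi M a b c d).
  by split=> //; apply: cards0_eq; rewrite e r0 cards0.
(* A left and a right switchback of a doubly decreasing rec form a conflict between [a] and [d]. *)
rewrite !inE /between => /and4P[/eqP fM cf fd fab] /and4P[/eqP eM ae eb ecd].
case: (noconf a e1 f d) => //; move: cf fd ae eb ecd fab ab' cd';
  rewrite /inversion /before; lia.
Qed.

End CrossingPositions.

(** * Potentials and removal of conflicts *)

Section Potential.
Variables (n : nat) (pi : 'S_n) (q : 'I_n -> 'I_n -> int).
Implicit Types x y z : 'I_n.
Local Notation inv := (inversion pi).
Local Notation p x := (nat_of_ord (position pi x)).
Hypothesis q_par : forall x x' y y',
  inv x y -> inv x' y -> inv x y' -> inv x' y' ->
  (q x y + q x' y' = q x' y + q x y')%R.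

(* All elements inverted with [x] can be compared through the suffix minima [m i]
   of the values: if [x] is inverted with [y], it is inverted with [m (p y)] and
   with every [m i] for [i] between the positions of [x] and [y].  So it suffices to
   integrate the increments of [q] along the suffix minima. *)
Lemma crossing_potential :
  exists u v : 'I_n -> int, forall x y, inv x y -> (q x y = v y - u x)%R.
Proof.
have [n0|n_gt0] := posnP n.
  by exists (fun=> 0%R), (fun=> 0%R) => x; have := ltn_ord x; rewrite {2}n0.
pose start i := pi (insubd (Ordinal n_gt0) i).
pose m i := [arg min_(y < start i | i <= p y) y].
have mP i : i < n -> i <= p (m i) /\ forall y, i <= p y -> m i <= y.
  move=> ltin; rewrite /m; case: arg_minnP => [|y yi ymin]; last by split.
  by rewrite /start position_perm val_insubd ltin.
(* By [q_par] the increment is the same for every admissible [x]; the default 0 is used only where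
   there is none. *)
pose w i : int := if [pick x | inv x (m i) && inv x (m i.+1)] is Some x
  then (q x (m i.+1) - q x (m i))%R else 0%R.
pose V i : int := (\sum_(j < i) w j)%R.
have VS i x : inv x (m i) -> inv x (m i.+1) ->
    (V i.+1 - q x (m i.+1) = V i - q x (m i))%R.
  move=> xi xi1; rewrite /V big_ord_recr /= /w.
  case: pickP => [x' /andP[x'i x'i1]|/(_ x)]; last by rewrite xi xi1.
  move: (q_par xi x'i xi1 x'i1) (\sum_(j < i) w j)%R; clear.
  move: (q x (m i)) (q x (m i.+1)) (q x' (m i)) (q x' (m i.+1)) => A B C D e E; lra.
pose u x : int := (V (p x) - q x (m (p x)))%R.
have uE x i : p x <= i < n -> inv x (m i) -> u x = (V i - q x (m i))%R.
  elim: i => [|i IHi] hi xi; first by rewrite /u (_ : p x = 0); last by lia.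
  have [<- //|xNi] := eqVneq (p x) i.+1.
  have [mi mi_min] := mP i ltac:(lia); have [mi1 _] := mP i.+1 ltac:(lia).
  have xi' : inv x (m i).
    have lex : m i < x.
      by have := mi_min (m i.+1) ltac:(lia); move: xi; rewrite /inversion; lia.
    have e := pos_eq pi (m i) x.
    by rewrite /inversion /before lex /=; lia.
  by rewrite VS // -IHi //; lia.
pose v y : int := if [pick x | inv x y] is Some x then (u x + q x y)%R else 0%R.
have m_inv x y : inv x y -> inv x (m (p y)).
  move=> xy; have [mi mi_min] := mP (p y) (ltn_ord _).
  by have := mi_min y (leqnn _); move: xy; rewrite /inversion /before; lia.
exists u, v => x y xy; rewrite /v; case: pickP => [x' x'y|/(_ x)]; last by rewrite xy.
have uyE z : inv z y -> u z = (V (p y) - q z (m (p y)))%R.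
  move=> zy; apply: uE; last exact: m_inv.
  by rewrite ltn_ord andbT; move: zy; rewrite /inversion /before; lia.
by rewrite !uyE //; have := q_par xy x'y (m_inv _ _ xy) (m_inv _ _ x'y); lra.
Qed.

End Potential.

(** * Exchanging the marks of a conflict *)

Section ConflictRemoval.
Variables (n : nat) (pi : 'S_n).
Implicit Types (M : 'I_n -> seq letter) (a b c d e x y z k j : 'I_n).
Local Notation inv := (inversion pi).
Local Notation p x := (nat_of_ord (position pi x)).
Local Notation LR := [:: L; R].
Local Notation RL := [:: R; L].

Lemma irregular_no_left M a b c d e : balanced_marking pi M -> rec pi a b c d ->
  ~~ regular a b c d -> M e = RL -> p a < p e -> p e < p b ->
  minn c d < e < maxn c d -> False.
Proof.
move=> [_ bal] r nr eM ae eb cd; have := bal _ _ _ _ r; rewrite (negPf nr) => -[h _].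
by have := in_set0 e; rewrite -h inE eM eqxx /= /before ae eb /between cd.
Qed.

Lemma irregular_no_right M a b c d e : balanced_marking pi M -> rec pi a b c d ->
  ~~ regular a b c d -> M e = LR -> p c < p e -> p e < p d ->
  minn a b < e < maxn a b -> False.
Proof.
move=> [_ bal] r nr eM ae eb cd; have := bal _ _ _ _ r; rewrite (negPf nr) => -[_ h].
by have := in_set0 e; rewrite -h inE eM eqxx /= /before ae eb /between cd.
Qed.

Section Conflict.
Variables (M : 'I_n -> seq letter) (x k j y : 'I_n).
Hypotheses (bal : balanced_marking pi M) (xk : inv x k) (xj : inv x j)
  (ky : inv k y) (jy : inv j y) (pkj : p k < p j) (kj : k < j)
  (kM : M k = RL) (jM : M j = LR).

(** In this and the next three lemmas [z] would complete the conflict to an irregular rec having [k]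
    as a left or [j] as a right switchback. Together with [conflict_inner] they describe the
    increasing block. *)
Lemma conflict_right z : ~~ [&& p j < p z, k < z & z < j].
Proof.
apply/negP => /and3P[jz kz zj].
have e := pos_eq pi y z; move: xk xj ky jy; rewrite /inversion /before => h1 h2 h3 h4.
have [yz|zy] := ltnP (p y) (p z).
  apply: (@irregular_no_left M x j y z k) => //; rewrite /rec /regular /before; lia.
apply: (@irregular_no_left M x j z y k) => //; rewrite /rec /regular /before; lia.
Qed.

Lemma conflict_left z : ~~ [&& p z < p k, k < z & z < j].
Proof.
apply/negP => /and3P[jz kz zj].
have e := pos_eq pi x z; move: xk xj ky jy; rewrite /inversion /before => h1 h2 h3 h4.
have [yz|zy] := ltnP (p x) (p z).
  apply: (@irregular_no_right M x z k y j) => //; rewrite /rec /regular /before; lia.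
apply: (@irregular_no_right M z x k y j) => //; rewrite /rec /regular /before; lia.
Qed.

Lemma conflict_above z : ~~ [&& p k < p z, p z < p j & j < z].
Proof.
apply/negP => /and3P[jz kz zj]; move: xk xj ky jy; rewrite /inversion /before => h1 h2 h3 h4.
apply: (@irregular_no_left M x z j y k) => //; rewrite /rec /regular /before; lia.
Qed.

Lemma conflict_below z : ~~ [&& p k < p z, p z < p j & z < k].
Proof.
apply/negP => /and3P[jz kz zj]; move: xk xj ky jy; rewrite /inversion /before => h1 h2 h3 h4.
apply: (@irregular_no_right M x k z y j) => //; rewrite /rec /regular /before; lia.
Qed.

Lemma conflict_inner b d : p k < p b -> p b < p d -> p d < p j ->
  k < d -> d < b -> b < j -> False.
Proof.
move: xk xj ky jy; rewrite /inversion /before => h1 h2 h3 h4 *.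
apply: (@irregular_no_left M x b d y k) => //; rewrite /rec /regular /before; lia.
Qed.

Lemma conflict_left_candidate a b c d : rec pi a b c d ->
  [&& before pi a k, before pi k b & between c d k] =
  [&& before pi a j, before pi j b & between c d j].
Proof.
move=> /recP[[ab bc cd] [ca cb da db]]; rewrite /before /between.
have [C [D [-> -> pbC pbD [CD Db Da]]]] : exists C D : 'I_n,
   [/\ minn c d = C, maxn c d = D, p b < p C, p b < p D & [/\ C <= D, D < b & D < a]].
  have [cltd|dc] := leqP c d; first by exists c, d; do !split=> //; lia.
  by exists d, c; do !split=> //; lia.
have rC := conflict_right C; have rD := conflict_right D.
apply/and3P/and3P => -[h1 h2 /andP[h3 h4]].
  (* Otherwise [b] and [D] would be an inversion strictly inside the block. *)
  have jb : p j < p b.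
    rewrite ltnNge; apply/negP => bj.
    have bj' : b <= j by move: (conflict_above b) (pos_eq pi b j) bj h2; clear; lia.
    have Dj := leq_trans Db bj'.
    have pDj : p D < p j by move: rD (pos_eq pi D j) h4 Dj; clear; lia.
    have bj'' : b < j.
      by move: (pos_eq pi b j) (ltn_trans pbD pDj) bj'; clear; lia.
    exact: conflict_inner h2 pbD pDj h4 Db bj''.
  split; [exact: ltn_trans h1 pkj|exact: jb|rewrite (ltn_trans h3 kj)].
  by move: rD (pos_eq pi D j) jb pbD h4; clear; lia.
split; last by move: rC (pos_eq pi C k) h3 h2 pbC pkj h4 kj; clear; lia.
  by move: (conflict_above a) (pos_eq pi a k) h1 h4 Da kj; clear; lia.
exact: ltn_trans pkj h2.
Qed.

Lemma conflict_right_candidate a b c d : rec pi a b c d ->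
  [&& before pi c k, before pi k d & between a b k] =
  [&& before pi c j, before pi j d & between a b j].
Proof.
move=> /recP[[ab bc cd] [ca cb da db]]; rewrite /before /between.
have [A [B [-> -> pAc pBc [AB cA dA]]]] : exists A B : 'I_n,
   [/\ minn a b = A, maxn a b = B, p A < p c, p B < p c & [/\ A <= B, c < A & d < A]].
  have [altb|ba] := leqP a b; first by exists a, b; do !split=> //; lia.
  by exists b, a; do !split=> //; lia.
have rA := conflict_left A; have rB := conflict_left B.
apply/and3P/and3P => -[h1 h2 /andP[h3 h4]].
  split; first exact: ltn_trans h1 pkj.
    by move: (conflict_below d) (pos_eq pi d j) h2 dA h3 kj; clear; lia.
  rewrite (ltn_trans h3 kj).
  by move: rB (pos_eq pi B j) h4 pBc h1 pkj; clear; lia.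
have ck : p c < p k.
  rewrite ltnNge; apply/negP => kc.
  have kc' : k <= c by move: (conflict_below c) (pos_eq pi c k) kc h1; clear; lia.
  have pkA : p k < p A by move: rA (pos_eq pi A k) kc' cA h3; clear; lia.
  have kc'' : k < c.
    by move: (pos_eq pi c k) (ltn_trans pkA pAc) kc'; clear; lia.
  exact: conflict_inner pkA pAc h1 kc'' cA h3.
split; [exact: ck|exact: ltn_trans pkj h2|rewrite (ltn_trans kj h4) andbT].
by move: rA (pos_eq pi A k) h3 pAc ck; clear; lia.
Qed.

(* By the preceding lemmas [k] and [j] are candidates for the same switchback
   sets, so that exchanging their marks preserves all counts. *)
Definition exchange : 'I_n -> seq letter := fun e => M (tperm k j e).

Lemma exchange_marking : marking_for pi exchange.
Proof.
case: bal => mk _ e; rewrite /exchange.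
have sb z x' y' : inv x' z -> inv z y' -> Defs.is_left pi z && is_right pi z.
  by move=> h1 h2; apply/andP; split; apply/existsP; [exists x'|exists y'].
case: tpermP => [->|->|_ _]; last exact: mk.
  have /andP[h1 h2] := sb _ _ _ xk ky.
  by rewrite /left_straight /right_straight h1 h2 jM; split=> //; left.
have /andP[h1 h2] := sb _ _ _ xj jy.
by rewrite /left_straight /right_straight h1 h2 kM; split=> //; right.
Qed.

Lemma exchange_left_switchbacks a b c d : rec pi a b c d ->
  left_switchbacks pi exchange a b c d =
  [set e | tperm k j e \in left_switchbacks pi M a b c d].
Proof.
move=> r; apply/setP => e; rewrite !inE /exchange; congr (_ && _).
by case: tpermP => [->|->|//]; rewrite (conflict_left_candidate r).
Qed.

Lemma exchange_right_switchbacks a b c d : rec pi a b c d ->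
  right_switchbacks pi exchange a b c d =
  [set e | tperm k j e \in right_switchbacks pi M a b c d].
Proof.
move=> r; apply/setP => e; rewrite !inE /exchange; congr (_ && _).
by case: tpermP => [->|->|//]; rewrite (conflict_right_candidate r).
Qed.

Lemma exchange_balanced : balanced_marking pi exchange.
Proof.
split=> [|a b c d r]; first exact: exchange_marking.
have := bal.2 _ _ _ _ r; rewrite /balanced_rec /empty_rec.
rewrite exchange_left_switchbacks // exchange_right_switchbacks //.
have cardE (A : {set 'I_n}) : #|[set e | tperm k j e \in A]| = #|A|.
  by rewrite -(card_preimset A (@perm_inj _ (tperm k j))).
case: ifP => _; first by rewrite !cardE.
by case=> -> ->; split; apply/setP => e; rewrite !inE.
Qed.

Lemma exchange_weight :
  \sum_(e | M e == RL) e < \sum_(e | exchange e == RL) e.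
Proof.
(* After reindexing both sums run over the RL elements of [M]; the term [k] becomes [j] and the
   others are unchanged, as [j] is not among them. *)
rewrite [X in _ < X](reindex_inj (@perm_inj _ (tperm k j))) /exchange /=.
rewrite [X in _ < X](eq_bigl (fun e => M e == RL)); last by move=> e; rewrite tpermK.
rewrite (bigD1 k) ?kM //= [X in _ < X](bigD1 k) ?kM //= tpermL.
apply: leq_add kj _; apply: leq_sum => e /andP[eM ek].
by case: tpermP eM ek => [->|->|//]; rewrite ?jM ?eqxx.
Qed.

End Conflict.

Lemma balanced_no_conflict M : balanced_marking pi M ->
  exists2 M', balanced_marking pi M' & no_conflict pi M'.
Proof.
pose W (M : 'I_n -> seq letter) := \sum_(e | M e == RL) e.
have W_le M1 : W M1 <= \sum_(e : 'I_n) e.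
  by rewrite /W [X in X <= _]big_mkcond leq_sum // => e _; case: ifP.
(* Induction on the distance of the weight from its upper bound. *)
have [w] := ubnP (\sum_(e : 'I_n) e - W M).
elim: w M => // w IHw M ltw bal.
have [cf|ncf] := boolP [exists t : 'I_n * 'I_n * 'I_n * 'I_n,
  let: (x, k, j, y) := t in
  [&& inv x k, inv x j, inv k y, inv j y, before pi k j, k < j, M k == RL & M j == LR]].
  case/existsP: cf => -[[[x k] j] y] /= /and5P[xk xj ky jy /and4P[pkj kj /eqP kM /eqP jM]].
  apply: (IHw (exchange M k j)); last exact: exchange_balanced xk xj ky jy pkj kj kM jM.
  have := exchange_weight kj kM jM; have := W_le (exchange M k j); have := W_le M.
  move: ltw; rewrite /W; lia.
exists M => // x k j y xk xj ky jy pkj kj kM jM; case/negP: ncf.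
apply/existsP; exists (x, k, j, y); rewrite /= xk xj ky jy pkj kj kM jM.
by rewrite !eqxx.
Qed.

End ConflictRemoval.

(** * From crossing times to a tangle *)

Section PermutationOrder.
Variable n : nat.
Implicit Types (rho : 'S_n) (x y z : 'I_n).

Lemma position_card rho z : position rho z = #|[set w | before rho w z]| :> nat.
Proof.
rewrite /before; set k := position rho z.
have cE : #|[set i : 'I_n | i < k]| = k.
  by rewrite -sum1dep_card (big_ord_narrow (ltnW (ltn_ord k))) sum1_card card_ord.
rewrite -[LHS]cE -(card_preimset _ (@position_inj n rho)).
by apply: eq_card => w; rewrite !inE.
Qed.

Lemma before_inj rho rho' : before rho =2 before rho' -> rho = rho'.
Proof.
move=> e; apply: invg_inj; apply/permP => z; apply: val_inj.
rewrite -[LHS]/(nat_of_ord (position rho z)) -[RHS]/(nat_of_ord (position rho' z)).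
by rewrite !position_card; apply: eq_card => w; rewrite !inE e.
Qed.

Lemma before_id x y : before (1%g : 'S_n) x y = (x < y).
Proof. by rewrite /before /position invg1 !perm1. Qed.

Lemma perm_of_order (r : rel 'I_n) : irreflexive r ->
    (forall x y, x != y -> r x y = ~~ r y x) -> transitive r ->
  {rho : 'S_n | before rho =2 r}.
Proof.
move=> r_irr r_tot r_trans; pose rank z := #|[set w in [set: 'I_n] | r w z]|.
have rank_n z : rank z < n.
  rewrite -[X in _ < X]card_ord -cardsT; apply: proper_card; apply/properP; split.
    exact: subsetT.
  by exists z; rewrite ?inE // r_irr.
have rk_lt x y : r x y -> rank x < rank y.
  by apply: (rank_lt r_irr); rewrite ?inE // => *; apply: r_trans; eassumption.
have rk x y : (rank x < rank y) = r x y.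
  apply/idP/idP => [xy|/rk_lt //]; have [e|ne] := eqVneq x y; first by rewrite e ltnn in xy.
  by rewrite r_tot //; apply/negP => /rk_lt; rewrite ltnNge (ltnW xy).
have inj : injective (fun z => Ordinal (rank_n z)).
  move=> x y [e]; apply/eqP/negPn/negP => ne; have := r_tot _ _ ne.
  by rewrite -!rk e ltnn.
exists ((perm inj)^-1)%g => x y.
by rewrite /before /position invgK !permE /= rk.
Qed.

End PermutationOrder.

Lemma card_at_most_one (T : finType) (P : pred T) :
  (forall x y, P x -> P y -> x = y) -> #|[set x | P x]| = [exists x, P x].
Proof.
move=> h; have [/existsP[x Px]|nP] := boolP [exists x, P x].
  rewrite -[RHS]/1 -(cards1 x); apply: eq_card => y; rewrite !inE.
  by apply/idP/eqP => [Py|-> //]; apply: h.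
apply/eqP; rewrite cards_eq0; apply/eqP/setP => x; rewrite !inE.
by apply/negbTE; apply: contra nP => Px; apply/existsP; exists x.
Qed.

(** * A perfect tangle from consistent crossing times *)

Section Tangle.
Variables (n : nat) (pi : 'S_n) (M : 'I_n -> seq letter).
Variables (t : 'I_n -> 'I_n -> nat) (N : nat).
Implicit Types (a b c x y z w : 'I_n) (s : nat).
Local Notation inv := (inversion pi).
Local Notation p x := (nat_of_ord (position pi x)).
Local Notation LR := [:: L; R].
Local Notation RL := [:: R; L].
Hypothesis mk : switchbacks_marked pi M.
Hypothesis t_bounds : forall x y, inv x y -> 0 < t x y < N.
Hypothesis t_left : forall x y z, inv x y -> inv x z ->
  left_first pi M y z -> t x y < t x z.
Hypothesis t_right : forall x y z, inv x y -> inv z y ->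
  right_first pi M x z -> t x y < t z y.
Hypothesis t_left_between : forall x y z s, inv x y -> inv x z ->
  t x y <= s <= t x z -> exists2 w, inv x w & t x w = s.
Hypothesis t_right_between : forall x y z s, inv x y -> inv z y ->
  t x y <= s <= t z y -> exists2 w, inv w y & t w y = s.

Lemma inversion_trans a b c : inv a b -> inv b c -> inv a c.
Proof. by rewrite /inversion /before; lia. Qed.

Lemma inversion_asym a b : inv a b -> inv b a = false.
Proof. by rewrite /inversion /before; lia. Qed.

(** The mark of the switchback [b] decides which of its two crossings comes first; in both cases
    [(a, c)] crosses in between. *)
Lemma t_between a b c : inv a b -> inv b c ->
  (t a b < t a c < t b c) || (t b c < t a c < t a b).
Proof.
move=> ab bc; have ac := inversion_trans ab bc; have e := mk ab bc.
have [bRL|bLR] := boolP (M b == RL).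
  have -> : t b c < t a c by apply: t_right => //; rewrite /right_first ab.
  have -> : t a c < t a b.
    by apply: t_left => //; rewrite /left_first inversion_asym // bc.
  by rewrite orbT.
rewrite bLR in e.
have -> : t a b < t a c by apply: t_left => //; rewrite /left_first bc.
by have -> : t a c < t b c by apply: t_right => //; rewrite /right_first inversion_asym // ab.
Qed.

Lemma t_inj_left x y z : inv x y -> inv x z -> t x y = t x z -> y = z.
Proof.
move=> xy xz e; apply/eqP/negPn/negP => yz.
have := left_first_total mk xy xz yz; have := t_left xy xz; have := t_left xz xy.
by case: (left_first _ _ y z); case: (left_first _ _ z y) => // + h; rewrite e => ?; lia.
Qed.

Lemma t_inj_right y x z : inv x y -> inv z y -> t x y = t z y -> x = z.
Proof.
move=> xy zy e; apply/eqP/negPn/negP => xz.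
have := right_first_total mk xy zy xz; have := t_right xy zy; have := t_right zy xy.
by case: (right_first _ _ x z); case: (right_first _ _ z x) => // + h; rewrite e => ?; lia.
Qed.

(** The strict inequality puts the crossing between the times [t a b] and [t a b + 1]. *)
Definition crossed s a b := inv a b && (t a b < s).

Definition order_at s a b := if p a < p b then ~~ crossed s a b else crossed s b a.

(** With [crossed_trans], this makes the crossed pairs closed and coclosed, as reversing them in the
    order of [pi] must again give a linear order. *)
Lemma crossed_split s a b c : p a < p b -> p b < p c -> crossed s a c ->
  crossed s a b || crossed s b c.
Proof.
move=> ab bc /andP[acI ts]; rewrite /crossed.
have [abI|abN] := boolP (inv a b); have [bcI|bcN] := boolP (inv b c) => /=.
- by have := t_between abI bcI; lia.
- rewrite orbF; apply: leq_trans ts; rewrite ltnS ltnW //; apply: t_left => //.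
  rewrite /left_first (negPf bcN).
  have -> : inv c b = false by rewrite /inversion /before; lia.
  exact: bc.
- apply: leq_trans ts; rewrite ltnS ltnW //; apply: t_right => //.
  rewrite /right_first (negPf abN).
  have -> : inv b a = false by rewrite /inversion /before; lia.
  exact: ab.
move: acI abN bcN ab bc (pos_eq pi a b) (pos_eq pi b c).
by rewrite /inversion /before; clear; lia.
Qed.

Lemma crossed_trans s a b c : crossed s a b -> crossed s b c -> crossed s a c.
Proof.
move=> /andP[ab sab] /andP[bc sbc]; rewrite /crossed (inversion_trans ab bc) /=.
by have := t_between ab bc; lia.
Qed.

Lemma order_at_irr s : irreflexive (order_at s).
Proof. by move=> a; rewrite /order_at /crossed /inversion /before !ltnn. Qed.

Lemma order_at_total s a b : a != b -> order_at s a b = ~~ order_at s b a.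
Proof.
move=> /negPf ab; have : (p a == p b) = false by rewrite pos_eq val_eqE ab.
rewrite /order_at.
by case: ltngtP => // _ _; rewrite negbK.
Qed.

Lemma order_at_trans s : transitive (order_at s).
Proof.
move=> b a c; rewrite /order_at.
have [ab|ba|/eqP] := ltngtP (p a) (p b); last by rewrite pos_eq val_eqE => /eqP ->.
- have [bc|cb|/eqP] := ltngtP (p b) (p c);
    last by rewrite pos_eq val_eqE => /eqP <-; rewrite ab.
  + rewrite (ltn_trans ab bc) => nab nbc; apply/negP => /(crossed_split ab bc).
    by rewrite (negPf nab) (negPf nbc).
  have [ac|ca|/eqP] := ltngtP (p a) (p c); last first.
  + by rewrite pos_eq val_eqE => /eqP ->; rewrite /crossed => /negPf ->.
  + by move=> nab cb'; have := crossed_split ca ab cb'; rewrite (negPf nab) orbF.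
  by move=> nab cb'; apply/negP => /crossed_trans/(_ cb'); apply/negP.
have [bc|cb|/eqP] := ltngtP (p b) (p c).
- have [ac|ca|/eqP] := ltngtP (p a) (p c); last first.
  + by rewrite pos_eq val_eqE => /eqP ->; rewrite /crossed => ->.
  + by move=> ba' nbc; have := crossed_split bc ca ba'; rewrite (negPf nbc).
  by move=> ba' nbc; apply/negP => /(crossed_trans ba'); apply/negP.
- by rewrite ltnNge (ltnW (ltn_trans cb ba)) /= => ba' cb'; apply: crossed_trans cb' ba'.
by rewrite pos_eq val_eqE => /eqP <-; rewrite ltnNge (ltnW ba) /= /crossed => -> .
Qed.

Definition perm_at_time s : 'S_n :=
  sval (perm_of_order (@order_at_irr s) (@order_at_total s) (@order_at_trans s)).

Lemma perm_at_timeE s : before (perm_at_time s) =2 order_at s.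
Proof. by rewrite /perm_at_time; case: perm_of_order. Qed.

Lemma perm_at_time_start s : s <= 1 -> perm_at_time s = pi.
Proof.
move=> s1; apply: before_inj => a b; rewrite perm_at_timeE /order_at /before.
have nc x y : crossed s x y = false.
  by apply/negP => /andP[/t_bounds]; lia.
by rewrite !nc; case: ifP.
Qed.

Lemma perm_at_time_end s : N <= s -> perm_at_time s = 1%g.
Proof.
move=> Ns; apply: before_inj => a b; rewrite perm_at_timeE before_id /order_at.
have c x y : crossed s x y = inv x y.
  rewrite /crossed; case: (boolP (inv x y)) => //= /t_bounds; lia.
have e := pos_eq pi a b.
by rewrite !c /inversion /before; case: ltnP; lia.
Qed.

Definition moves_right s z := [exists w, inv z w && (t z w == s)].
Definition moves_left s z := [exists w, inv w z && (t w z == s)].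

Lemma order_at_step s w z :
  ((order_at s.+1 w z : nat)%:Z - (order_at s w z : nat)%:Z =
   (inv z w && (t z w == s) : nat)%:Z - (inv w z && (t w z == s) : nat)%:Z)%R.
Proof.
rewrite /order_at /crossed; case: ltnP => wz.
  have -> : inv z w = false by rewrite /inversion /before; lia.
  by case: (inv w z) => //=; case: (ltngtP (t w z) s); lia.
have -> : inv w z = false by rewrite /inversion /before; lia.
by case: (inv z w) => //=; case: (ltngtP (t z w) s); lia.
Qed.

(** The position counts the elements to the left. By injectivity of [t] in each argument, at most
    one element enters this set and at most one leaves it. *)
Lemma position_step s z :
  ((position (perm_at_time s.+1) z)%:Z =
   (position (perm_at_time s) z)%:Z + (moves_right s z : nat)%:Z
     - (moves_left s z : nat)%:Z)%R.
Proof.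
have cE u : ((position (perm_at_time u) z)%:Z = \sum_w (order_at u w z : nat)%:Z)%R.
  rewrite position_card -card_sumZ; congr Posz.
  by apply: eq_card => w; rewrite !inE perm_at_timeE.
have rE : ((moves_right s z : nat)%:Z = \sum_w (inv z w && (t z w == s) : nat)%:Z)%R.
  rewrite -card_sumZ card_at_most_one // => w w' /andP[zw /eqP e] /andP[zw' /eqP e'].
  by apply: (t_inj_left zw zw'); rewrite e e'.
have lE : ((moves_left s z : nat)%:Z = \sum_w (inv w z && (t w z == s) : nat)%:Z)%R.
  rewrite -card_sumZ card_at_most_one // => w w' /andP[zw /eqP e] /andP[zw' /eqP e'].
  by apply: (t_inj_right zw zw'); rewrite e e'.
apply/eqP; rewrite -addrA addrC -subr_eq !cE rE lE -!sumrB.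
by apply/eqP/eq_bigr => w _; rewrite order_at_step.
Qed.

Lemma moves_excl s z : moves_right s z -> moves_left s z = false.
Proof.
case/existsP=> y /andP[zy /eqP zs]; apply/negbTE/negP.
rewrite /moves_left => /existsP[x /andP[xz /eqP xs]].
by have := t_between xz zy; rewrite zs xs; lia.
Qed.

Lemma position_moves_right s z :
  ((position (perm_at_time s.+1) z)%:Z = (position (perm_at_time s) z)%:Z + 1)%R
  <-> moves_right s z.
Proof.
rewrite position_step; have := @moves_excl s z.
case: (moves_right s z) => [/(_ isT) ->|_]; split=> //; first by rewrite subr0.
by case: (moves_left s z); lia.
Qed.

Lemma position_moves_left s z :
  ((position (perm_at_time s.+1) z)%:Z = (position (perm_at_time s) z)%:Z + -1)%R
  <-> moves_left s z.
Proof.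
rewrite position_step; have := @moves_excl s z.
case: (moves_right s z) => [/(_ isT) ->|_]; first by split=> //; lia.
by case: (moves_left s z); split=> //; lia.
Qed.

Lemma moves_right_convex z u v r : u < v < r ->
  moves_right u z -> moves_right r z -> moves_right v z.
Proof.
move=> uvw /existsP[y /andP[zy /eqP yu]] /existsP[y' /andP[zy' /eqP yw]].
have [|y'' zy'' yv] := t_left_between (s := v) zy zy'; first by lia.
by apply/existsP; exists y''; rewrite zy'' yv eqxx.
Qed.

Lemma moves_left_convex z u v r : u < v < r ->
  moves_left u z -> moves_left r z -> moves_left v z.
Proof.
move=> uvw /existsP[y /andP[zy /eqP yu]] /existsP[y' /andP[zy' /eqP yw]].
have [|y'' zy'' yv] := t_right_between (s := v) zy zy'; first by lia.
by apply/existsP; exists y''; rewrite zy'' yv eqxx.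
Qed.

Lemma perfect_of_times : perfect pi.
Proof.
(* All crossing times lie strictly between 0 and [N], so times 0 and 1 both show [pi] and times [N]
   and [N + 1] the identity, as the convention on the ends demands. *)
pose T := mkseq perm_at_time N.+2.
have sT : size T = N.+2 by rewrite size_mkseq.
have TE s : s < N.+2 -> perm_at T s = perm_at_time s.
  by move=> hs; rewrite /perm_at nth_mkseq.
have step z s : s.+1 < size T ->
    (-1 <= (position (perm_at T s.+1) z)%:Z - (position (perm_at T s) z)%:Z <= 1)%R.
  rewrite sT => hs; rewrite !TE; [|lia|lia]; rewrite position_step.
  by case: (moves_right s z); case: (moves_left s z); lia.
exists T; split.
- split; first by rewrite sT.
  + move=> s hs; apply/adjacentP => z; have := step z s hs.
    move: (nat_of_ord (position _ _)) (nat_of_ord (position _ _)); clear => i j; lia.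
  + by rewrite !TE // !perm_at_time_start.
  by rewrite sT !subSS subn0 subn0 !TE // !perm_at_time_end.
- by split; [rewrite TE // perm_at_time_start|rewrite sT TE // perm_at_time_end].
split.
- have cr x y s : s.+1 < size T -> crosses_at T x y s ->
      (inv x y && (t x y == s)) || (inv y x && (t y x == s)).
    rewrite sT => hs; rewrite /crosses_at !TE; [|lia|lia].
    rewrite !perm_at_timeE; have := order_at_step s x y.
    by case: (order_at s x y); case: (order_at s.+1 x y) => //;
      case: (inv y x && _); case: (inv x y && _).
  move=> x y s u hs hu /(cr _ _ _ hs) + /(cr _ _ _ hu).
  have [xy|_] := boolP (inv x y); last by move=> /andP[_ /eqP <-] /andP[_ /eqP <-].
  by rewrite inversion_asym // !orbF => /eqP <- /eqP <-.
- move=> x s u s' u' [seg d] [seg' d'].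
  apply: (@segment_uniq _ T x (step x) (-1)) seg _ seg' _;
    [by right| |by move: d => /=; lia|by move: d' => /=; lia].
  move=> a b c abc; rewrite sT => hc; rewrite !TE; [|lia..].
  move=> /position_moves_left h1 /position_moves_left h2.
  by apply/position_moves_left; exact: moves_left_convex abc h1 h2.
move=> x s u s' u' [seg d] [seg' d'].
apply: (@segment_uniq _ T x (step x) 1) seg _ seg' _;
  [by left| |by move: d => /=; lia|by move: d' => /=; lia].
move=> a b c abc; rewrite sT => hc; rewrite !TE; [|lia..].
move=> /position_moves_right h1 /position_moves_right h2.
  by apply/position_moves_right; exact: moves_right_convex abc h1 h2.
Qed.

End Tangle.

Lemma balanced_perfect (n : nat) (pi : 'S_n) (M : 'I_n -> seq letter) :
  balanced_marking pi M -> no_conflict pi M -> perfect pi.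
Proof.
move=> bal noconf; have mk := marking_switchbacks bal.1.
have par := balanced_parallelogram mk bal.
have [x x' y y' h1 h2 h3 h4|u [v uv]] :=
    @crossing_potential n pi (fun x y => (crossing_pos pi M x y)%:Z%R).
  by have := par _ _ _ _ h1 h2 h3 h4; lia.
pose K := \sum_x \sum_y absz (u x + v y)%R.
have K_ge x y : absz (u x + v y)%R <= K.
  rewrite /K (bigD1 x) //= (bigD1 y) //=.
  by rewrite -addnA leq_addr.
(* The shift by [K + 1] puts every time strictly between 0 and [K + K + 2]. *)
pose t x y := absz (u x + v y + K%:Z + 1)%R.
have tE x y : (t x y)%:Z%R = (u x + v y + K%:Z + 1)%R.
  by have := K_ge x y; rewrite /t; lia.
(* With the position equal to [v y - u x], time minus position depends only on [x] and time plus
   position only on [y]. This transfers order and intermediate values from positions to times. *)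
have tl x y z : inversion pi x y -> inversion pi x z ->
    ((t x y)%:Z - (crossing_pos pi M x y)%:Z =
     (t x z)%:Z - (crossing_pos pi M x z)%:Z)%R.
  by move=> xy xz; rewrite !tE !uv //; move: (u x) (v y) (v z); clear; lia.
have tr x y z : inversion pi x y -> inversion pi z y ->
    ((t x y)%:Z + (crossing_pos pi M x y)%:Z =
     (t z y)%:Z + (crossing_pos pi M z y)%:Z)%R.
  by move=> xy zy; rewrite !tE !uv //; move: (u x) (u z) (v y); clear; lia.
apply: (@perfect_of_times n pi M t (K + K + 2)) => //.
- by move=> x y _; have := K_ge x y; have := tE x y; lia.
- move=> x y z xy xz /(crossing_pos_left_lt mk noconf xy xz).
  by have := tl _ _ _ xy xz; lia.
- move=> x y z xy zy /(crossing_pos_right_lt mk noconf xy zy).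
  by have := tr _ _ _ xy zy; lia.
- move=> x y z s xy xz yz; have e := tl _ _ _ xy xz.
  have [|w xw we] := crossing_pos_left_between mk noconf xy xz
    (i := s + crossing_pos pi M x y - t x y); first by lia.
  by exists w => //; have := tl _ _ _ xy xw; lia.
move=> x y z s xy zy yz; have e := tr _ _ _ xy zy.
have [|w wy we] := crossing_pos_right_between mk noconf zy xy
  (i := t x y + crossing_pos pi M x y - s); first by lia.
by exists w => //; have := tr _ _ _ xy wy; lia.
Qed.

(** * From a perfect tangle to a balanced marking *)

Lemma bool_change (f : nat -> bool) u v : u <= v -> f u != f v ->
  exists w, u <= w < v /\ f w != f w.+1.
Proof.
elim: v => [|v IHv] uv fuv; first by move: fuv; rewrite (_ : u = 0) ?eqxx //; lia.
have [e|neq] := eqVneq u v.+1; first by rewrite e eqxx in fuv.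
have {neq}uv' : u <= v by lia.
have [e|ne] := eqVneq (f u) (f v); first by exists v; rewrite uv' leqnn -e.
by have [w [uw fw]] := IHv uv' ne; exists w; split=> //; lia.
Qed.

Section CrossingTimes.
Variables (n : nat) (pi : 'S_n) (T : seq 'S_n).
Implicit Types (x y z : 'I_n) (s u v r : nat).
Local Notation inv := (inversion pi).
Local Notation p x := (nat_of_ord (position pi x)).
Local Notation N := (size T).
Local Notation P s x := (nat_of_ord (position (perm_at T s) x)).
Local Notation B s x y := (before (perm_at T s) x y).
Local Notation LR := [:: L; R].
Local Notation RL := [:: R; L].
Hypothesis tangleT : is_tangle T.
Hypothesis solvesT : solves T pi.
Hypothesis perfectT : perfect_tangle T.

Lemma tangle_close s : s.+1 < N -> close (perm_at T s) (perm_at T s.+1).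
Proof. by case: tangleT => _ adj _ _ /adj/adjacentP. Qed.

Lemma path_eq s x y : (P s x == P s y) = (x == y).
Proof. by rewrite pos_eq val_eqE. Qed.

Lemma before_total s x y : x != y -> B s x y = ~~ B s y x.
Proof. by move=> /negPf; rewrite -(path_eq s) /before; lia. Qed.

Lemma before_trans s x y z : B s x y -> B s y z -> B s x z.
Proof. exact: ltn_trans. Qed.

Lemma size_tangle : 1 < N. Proof. by case: tangleT. Qed.

Lemma before_start x y : B 0 x y = before pi x y.
Proof. by case: solvesT => ->. Qed.

Lemma before_end x y : B N.-1 x y = (x < y).
Proof. by case: solvesT => _ ->; rewrite before_id. Qed.

(** A second change of order would be a second crossing, against simplicity. *)
Lemma no_return x y u v r : u < v < r -> r < N -> B u x y != B v x y ->
  B v x y = B r x y.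
Proof.
move=> uvr rN c1; have [//|c2] := eqVneq (B v x y) (B r x y).
have [|w [uw cw]] := bool_change (f := fun s => B s x y) _ c1; first by lia.
have [|w' [vw' cw']] := bool_change (f := fun s => B s x y) _ c2; first by lia.
have [sT _ _] := perfectT.
have [h1 h2] : w.+1 < N /\ w'.+1 < N by lia.
by have := sT x y w w' h1 h2 cw cw'; lia.
Qed.

Lemma before_stable x y s : p x < p y -> x < y -> s < N -> B s x y.
Proof.
move=> pxy xy sN; have b0 := before_start x y; have bN := before_end x y.
rewrite /before pxy in b0; rewrite xy in bN.
have [->|s0] := posnP s; first exact: b0.
have [->|sN'] := eqVneq s N.-1; first exact: bN.
have [//|nb] := boolP (B s x y); have sN1 : 0 < s < N.-1 by lia.
have := no_return (x := x) (y := y) sN1 (ltac:(lia)).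
by rewrite bN {1}/before b0 (negPf nb) => /(_ isT).
Qed.

(* Meaningful only when [(x, y)] is an inversion. *)
Definition cross_time x y := (find (fun s => ~~ B s x y) (iota 0 N)).-1.
Local Notation t := cross_time.

Lemma cross_timeP x y : inv x y ->
  (t x y).+1 < N /\ forall s, s < N -> B s x y = (s <= t x y).
Proof.
move=> /andP[yx xy]; have b0 := before_start x y; have bN := before_end x y.
rewrite xy in b0; rewrite ltnNge (ltnW yx) /= in bN.
have N0 := size_tangle.
have hs : has (fun s => ~~ B s x y) (iota 0 N).
  by apply/hasP; exists N.-1; rewrite ?mem_iota ?bN //; lia.
rewrite /t; set f := find _ _.
have fN : f < N by have := hs; rewrite has_find size_iota.
have nbf : ~~ B f x y by have := nth_find 0 hs; rewrite nth_iota.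
have bf s : s < f -> B s x y.
  move=> sf; have := before_find 0 sf; rewrite nth_iota ?add0n; last by lia.
  by move=> /= /negbFE.
have f0 : 0 < f by rewrite lt0n; apply/eqP => f0; rewrite f0 b0 in nbf.
rewrite prednK //; split=> // s sN; rewrite -ltnS prednK //.
have [/bf //|fs] := ltnP s f; apply/negbTE.
move: fs; rewrite leq_eqVlt => /orP[/eqP <- //|fs].
have fs' : 0 < f < s by rewrite f0.
by rewrite -(no_return (x := x) (y := y) fs') // b0 (negPf nbf).
Qed.

Lemma cross_time_before x y s : inv x y -> s < N -> B s x y = (s <= t x y).
Proof. by case/cross_timeP=> _; apply. Qed.

Lemma cross_time_after x y s : inv x y -> s < N -> B s y x = (t x y < s).
Proof.
move=> xy sN; rewrite before_total ?cross_time_before // -?ltnNge //.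
by apply/eqP => e; move: xy; rewrite e /inversion ltnn.
Qed.

(** Each path moves by at most one position while the order is reversed, so the two are neighbours
    and trade places. *)
Lemma cross_step x y : inv x y ->
  [/\ P (t x y) y = (P (t x y) x).+1, P (t x y).+1 x = (P (t x y) x).+1
    & P (t x y).+1 y = P (t x y) x].
Proof.
move=> xy; have [tN _] := cross_timeP xy.
have := cross_time_before xy (ltnW tN); have := cross_time_after xy tN.
have := tangle_close tN x; have := tangle_close tN y.
by rewrite /before !leqnn; split; lia.
Qed.

Lemma cross_time_inj_left x y z : inv x y -> inv x z -> t x y = t x z -> y = z.
Proof.
move=> /cross_step[ey _ _] /cross_step[ez _ _] e.
by apply/eqP; rewrite -(path_eq (t x y)) ey {2}e ez e.
Qed.

Local Notation X s x := ((position (perm_at T s) x)%:Z%R).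

Lemma tangle_step x s : s.+1 < N -> (-1 <= X s.+1 x - X s x <= 1)%R.
Proof.
by move=> /tangle_close/(_ x) []; move: (P s x) (P s.+1 x); clear; lia.
Qed.

Lemma right_steps_convex x u v r : u < v < r -> r.+1 < N ->
  (X u.+1 x = X u x + 1 -> X r.+1 x = X r x + 1 -> X v.+1 x = X v x + 1)%R.
Proof.
apply: (steps_convex (@tangle_step x)); first by left.
move=> s s' w w' seg d seg' d'; have [_ _ uniqR] := perfectT.
by apply: (uniqR x); split=> //=; lia.
Qed.

Lemma left_steps_convex x u v r : u < v < r -> r.+1 < N ->
  (X u.+1 x = X u x + -1 -> X r.+1 x = X r x + -1 -> X v.+1 x = X v x + -1)%R.
Proof.
apply: (steps_convex (@tangle_step x)); first by right.
move=> s s' w w' seg d seg' d'; have [_ uniqL _] := perfectT.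
by apply: (uniqL x); split=> //=; lia.
Qed.

Lemma cross_step_right x y : inv x y -> (X (t x y).+1 x = X (t x y) x + 1)%R.
Proof. by case/cross_step=> _ -> _; lia. Qed.

Lemma cross_step_left x y : inv x y -> (X (t x y).+1 y = X (t x y) y + -1)%R.
Proof. by case/cross_step=> -> _ ->; lia. Qed.

(** Both crossings are steps to the right of [x], and convexity fills the time between them with
    such steps. *)
Lemma right_line x y z : inv x y -> inv x z ->
  (X (t x y) x - (t x y)%:Z = X (t x z) x - (t x z)%:Z)%R.
Proof.
wlog le : y z / t x y <= t x z => [hw xy xz|xy xz].
  by have [le|/ltnW le] := leqP (t x y) (t x z); [|symmetry]; apply: hw.
have [zN _] := cross_timeP xz.
have sl : has_slope T x 1 (t x y) (t x z).
  apply: step_has_slope => u /andP[yu uz].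
  move: yu; rewrite leq_eqVlt => /orP[/eqP <-|yu]; first exact: cross_step_right.
  by apply: (right_steps_convex (u := t x y) (r := t x z)); rewrite ?yu // cross_step_right.
by rewrite (sl (t x z)) ?le ?leqnn //; ring.
Qed.

Lemma left_line x y z : inv x y -> inv z y ->
  (X (t x y) y + (t x y)%:Z = X (t z y) y + (t z y)%:Z)%R.
Proof.
wlog le : x z / t x y <= t z y => [hw xy zy|xy zy].
  by have [le|/ltnW le] := leqP (t x y) (t z y); [|symmetry]; apply: hw.
have [zN _] := cross_timeP zy.
have sl : has_slope T y (-1) (t x y) (t z y).
  apply: step_has_slope => u /andP[yu uz].
  move: yu; rewrite leq_eqVlt => /orP[/eqP <-|yu]; first exact: cross_step_left.
  by apply: (left_steps_convex (u := t x y) (r := t z y)); rewrite ?yu // cross_step_left.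
by rewrite (sl (t z y)) ?le ?leqnn //; ring.
Qed.

Lemma left_right_neq x z y : inv x z -> inv z y -> t x z != t z y.
Proof.
move=> xz zy; apply/eqP => e; have := cross_step_left xz; have := cross_step_right zy.
by rewrite e; move: (X _ _) (X _ _) => i j; lia.
Qed.

(** The left steps of [z] and its right steps occupy disjoint time intervals, so one comparison
    decides all. This makes [tangle_marking] independent of the crossings chosen in its test. *)
Lemma left_right_order x x' z y y' : inv x z -> inv x' z -> inv z y -> inv z y' ->
  t x z < t z y -> t x' z < t z y'.
Proof.
move=> xz x'z zy zy' lt; rewrite ltn_neqAle left_right_neq //= leqNgt; apply/negP => lt'.
have sxz := cross_step_left xz; have sx'z := cross_step_left x'z.
have szy := cross_step_right zy; have szy' := cross_step_right zy'.
have [zN _] := cross_timeP zy; have [zN' _] := cross_timeP x'z.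
have := left_right_neq x'z zy; rewrite neq_ltn => /orP[l|l].
  have := right_steps_convex (u := t z y') (v := t x' z) (r := t z y) _ zN szy' szy.
  by rewrite lt' l => /(_ isT); move: sx'z; move: (X _ _) (X _ _) => i j; lia.
have := left_steps_convex (u := t x z) (v := t z y) (r := t x' z) _ zN' sxz sx'z.
by rewrite lt l => /(_ isT); move: szy; move: (X _ _) (X _ _) => i j; lia.
Qed.

Definition tangle_marking i : seq letter :=
  if switchback pi i then
    if [exists x, exists y, [&& inv x i, inv i y & t x i < t i y]] then LR else RL
  else if Defs.is_left pi i then [:: L] else if is_right pi i then [:: R] else [::].
Local Notation M := tangle_marking.

Lemma tangle_marking_for : marking_for pi M.
Proof.
move=> i; rewrite /M /left_straight /right_straight /switchback.
case: (Defs.is_left pi i); case: (is_right pi i) => //=; split=> // _.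
by case: ifP; [left|right].
Qed.

Lemma tangle_marking_LR x z y : inv x z -> inv z y -> (M z == LR) = (t x z < t z y).
Proof.
move=> xz zy; rewrite /M; have -> : switchback pi z.
  by apply/andP; split; apply/existsP; [exists x|exists y].
case: ifP => [/existsP[x' /existsP[y' /and3P[x'z zy' lt]]]|nex].
  by rewrite eqxx (left_right_order x'z xz zy' zy lt).
symmetry; apply/negbTE/negP => lt; case/negP: (negbT nex).
by apply/existsP; exists x; apply/existsP; exists y; rewrite xz zy lt.
Qed.

Lemma tangle_marking_switchbacks : switchbacks_marked pi M.
Proof. exact: marking_switchbacks tangle_marking_for. Qed.

Lemma tangle_marking_RL x z y : inv x z -> inv z y -> (M z == RL) = (t z y < t x z).
Proof.
move=> xz zy; have := tangle_marking_switchbacks xz zy.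
rewrite (tangle_marking_LR xz zy); have := left_right_neq xz zy.
by case: (M z == RL); case: ltngtP.
Qed.

(** At time [t x z] the path [x] is still before [z], and [z] before [y]; so [x] has not yet crossed
    [y]. *)
Lemma cross_time_LR x z y : inv x z -> inv z y -> t x z < t z y -> t x z < t x y.
Proof.
move=> xz zy lt; have [tN _] := cross_timeP xz.
have xy : inv x y by move: xz zy; rewrite /inversion /before; clear; lia.
have b : B (t x z) x y.
  apply: (@before_trans _ x z y); rewrite cross_time_before //; try lia.
rewrite cross_time_before // in b; last by lia.
rewrite ltn_neqAle b andbT; apply/eqP => /(cross_time_inj_left xz xy) e.
by move: zy; rewrite e /inversion ltnn.
Qed.

Lemma cross_time_RL x z y : inv x z -> inv z y -> t z y < t x z -> t x y < t x z.
Proof.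
move=> xz zy lt; have [tN _] := cross_timeP xz.
have xy : inv x y by move: xz zy; rewrite /inversion /before; clear; lia.
have b : B (t x z).+1 y x.
  by apply: (@before_trans _ y z x); rewrite cross_time_after //; lia.
rewrite cross_time_after // ltnS in b.
rewrite ltn_neqAle b andbT; apply/eqP => /(cross_time_inj_left xy xz) e.
by move: zy; rewrite e /inversion ltnn.
Qed.

(** The paths [y] and [z] never cross, so once [z] has passed [x], so has [y]. *)
Lemma cross_time_parallel x y z : inv x y -> inv x z -> p y < p z -> y < z ->
  t x y < t x z.
Proof.
move=> xy xz pyz yz; have [tN _] := cross_timeP xz.
have b : B (t x z).+1 y x.
  apply: (@before_trans _ y z x); last by rewrite cross_time_after.
  exact: before_stable.
rewrite cross_time_after // ltnS in b.
rewrite ltn_neqAle b andbT; apply/eqP => /(cross_time_inj_left xy xz) e.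
by rewrite e ltnn in yz.
Qed.

Lemma left_first_cross_time x z y : inv x z -> inv x y ->
  left_first pi M z y = (t x z < t x y).
Proof.
move=> xz xy; rewrite /left_first; case: ifP => [zy|zyN].
  rewrite (tangle_marking_LR xz zy); have := left_right_neq xz zy.
  rewrite neq_ltn => /orP[lt|lt]; first by rewrite lt (cross_time_LR xz zy).
  by rewrite !ltnNge (ltnW lt) (ltnW (cross_time_RL xz zy lt)).
case: ifP => [yz|yzN].
  rewrite (tangle_marking_RL xy yz); have := left_right_neq xy yz.
  rewrite neq_ltn => /orP[lt|lt]; last by rewrite lt (cross_time_RL xy yz).
  by rewrite !ltnNge (ltnW lt) (ltnW (cross_time_LR xy yz lt)).
have e := pos_eq pi z y; move: zyN yzN; rewrite /inversion /before.
have [lt|gt|eq] := ltngtP (p z) (p y) => h1 h2.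
- by symmetry; apply: cross_time_parallel => //; lia.
- by symmetry; apply/negbTE; rewrite -leqNgt ltnW //; apply: cross_time_parallel => //; lia.
move/eqP: eq; rewrite e => /eqP/val_inj ->; by rewrite ltnn.
Qed.

Lemma left_of_cross_time x y z : inv x y -> left_of pi M z x y = B (t x y) z x.
Proof.
move=> xy; have [tN _] := cross_timeP xy.
rewrite /left_of; case: ifP => [xz|xzN].
  by rewrite (left_first_cross_time xz xy) cross_time_after //; apply: ltnW.
case: ifP => [zx|zxN].
  rewrite cross_time_before //; last by lia.
  by rewrite (tangle_marking_RL zx xy) [RHS]leq_eqVlt eq_sym (negPf (left_right_neq zx xy)).
have e := pos_eq pi z x; move: zxN xzN; rewrite /inversion /before => h1 h2.
have [lt|gt|eq] := ltngtP (p z) (p x).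
- have zx : z < x by move: h1 h2 e lt; clear; lia.
  by symmetry; apply: (before_stable lt zx); apply: ltnW.
- have xz : x < z by move: h1 h2 e gt; clear; lia.
  have := before_stable gt xz (ltnW tN).
  by rewrite /before => xz'; rewrite ltnNge (ltnW xz').
by move/eqP: eq; rewrite e => /eqP/val_inj ->; rewrite ltnn.
Qed.

Lemma crossing_pos_cross_time x y : inv x y -> crossing_pos pi M x y = P (t x y) x.
Proof.
move=> xy; rewrite position_card; apply: eq_card => z.
by rewrite !inE left_of_cross_time.
Qed.

Lemma tangle_parallelogram : parallelogram pi M.
Proof.
move=> x x' y y' xy x'y xy' x'y'; rewrite !crossing_pos_cross_time //.
have := right_line xy xy'; have := right_line x'y x'y'.
have := left_line xy x'y; have := left_line xy' x'y'.
have [-> _ _] := cross_step xy; have [-> _ _] := cross_step xy'.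
have [-> _ _] := cross_step x'y; have [-> _ _] := cross_step x'y'.
move: (P (t x y) x) (P (t x y') x) (P (t x' y) x') (P (t x' y') x').
move: (t x y) (t x y') (t x' y) (t x' y'); clear; lia.
Qed.

(** A conflict would give the cycle [t k y < t x k < t x j < t j y <= t k y]: the outer inequalities
    come from the marks and from [k] always being before [j], the middle one from
    [cross_time_parallel]. *)
Lemma tangle_no_conflict : no_conflict pi M.
Proof.
move=> x k j y xk xj ky jy pkj kj /eqP kM /eqP jM.
rewrite (tangle_marking_RL xk ky) in kM; rewrite (tangle_marking_LR xj jy) in jM.
have xkj := cross_time_parallel xk xj pkj kj.
have [tN _] := cross_timeP ky.
have b : B (t k y).+1 y j.
  apply: (@before_trans _ y k j); last exact: before_stable.
  by rewrite cross_time_after.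
rewrite cross_time_after // ltnS in b; lia.
Qed.

Lemma tangle_balanced : balanced_marking pi M.
Proof.
split; first exact: tangle_marking_for.
exact: parallelogram_balanced tangle_marking_switchbacks tangle_no_conflict
  tangle_parallelogram.
Qed.

End CrossingTimes.

Theorem theorem3 (n : nat) (pi : 'S_n) :
  perfect pi <-> exists M : 'I_n -> seq letter, balanced_marking pi M.
Proof.
split=> [[T [tangleT solvesT perfectT]]|[M bal]].
  by exists (tangle_marking pi T); apply: tangle_balanced.
have [M' bal' noconf] := balanced_no_conflict bal.
exact: balanced_perfect bal' noconf.
Qed.
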